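(* Let $n\ge2$, let $\Omega\subset\mathbb{R}^n$ be a domain, $\alpha\in[0,1)$ and $p\in[1,\frac{n}{1-\alpha})$. Then there exists a constant $C_2=C_2(n,p,\alpha,F)>0$ such that for every $v\in C_c^\infty(\Omega)$ \[ \big\|d_F^{1/p'-\alpha}v\big\|^p_{L^{p^{*,\alpha}}(\Omega)}\le C_2\int_\Omega\Big(\frac{|v|^p}{d_F}+d_F^{p-1}F^p(\nabla v)\Big)dx, \] where $p'$ is the Hölder conjugate of $p$ (with $1/p'=0$ if $p=1$).
   Context: A domain is a connected open set $\Omega\subset\mathbb{R}^n$ with nonempty boundary. $F:\mathbb{R}^n\to[0,\infty)$ is a strictly convex norm (an even, positively $1$-homogeneous convex function, positive except at the origin, whose unit ball $\{F<1\}$ is strictly convex), with $F\in C^1(\mathbb{R}^n\setminus\{0\})$. Its polar is $F^o(\eta)=\sup_{\xi\ne0}\frac{\xi\cdot\eta}{F(\xi)}$. The anisotropic distance to the boundary is $d_F(x)=\inf_{y\in\partial\Omega}F^o(x-y)$, $x\in\overline\Omega$. For $\alpha\in[0,1)$ and $1\le p<\frac{n}{1-\alpha}$, $p^{*,\alpha}:=\frac{np}{n-p(1-\alpha)}$. *)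

(* Defs.v *)
From HB Require Import structures.
From mathcomp Require Import all_boot all_order all_algebra.
From mathcomp Require Import all_classical all_reals all_analysis.
Set Implicit Arguments. Unset Strict Implicit. Unset Printing Implicit Defensive.
Import Order.TTheory GRing.Theory Num.Theory.
Import numFieldNormedType.Exports.
Local Open Scope classical_set_scope.
Local Open Scope ring_scope.

Section Defs.
Variable R : realType.

Definition evec (n : nat) (i : 'I_n) : 'rV[R]_n := delta_mx 0 i.

Definition dotp (n : nat) (x y : 'rV[R]_n) : R := \sum_(i < n) x 0 i * y 0 i.

Fixpoint ipartial (n : nat) (s : seq 'I_n) (f : 'rV[R]_n -> R) : 'rV[R]_n -> R :=
  match s with
  | [::] => f
  | i :: s' => fun x => 'D_(evec i) (ipartial s' f) x
  end.

Definition smooth (n : nat) (f : 'rV[R]_n -> R) : Prop :=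
  forall s : seq 'I_n,
    continuous (ipartial s f) /\ forall (i : 'I_n) x, derivable (ipartial s f) x (evec i).

Definition support (n : nat) (f : 'rV[R]_n -> R) : set 'rV[R]_n :=
  closure [set x | f x != 0].

Definition Cc_infty (n : nat) (Omega : set 'rV[R]_n) (f : 'rV[R]_n -> R) : Prop :=
  smooth f /\ compact (support f) /\ support f `<=` Omega.

Definition boundary (n : nat) (A : set 'rV[R]_n) : set 'rV[R]_n :=
  closure A `\` interior A.

Definition domain (n : nat) (Omega : set 'rV[R]_n) : Prop :=
  open Omega /\ connected Omega /\ boundary Omega !=set0.

Definition gradient (n : nat) (f : 'rV[R]_n -> R) (x : 'rV[R]_n) : 'rV[R]_n :=
  \row_(i < n) 'D_(evec i) f x.

Definition strictly_convex_set (n : nat) (A : set 'rV[R]_n) : Prop :=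
  forall (x y : 'rV[R]_n) (t : R), closure A x -> closure A y -> x != y ->
    0 < t < 1 -> interior A ((1 - t) *: x + t *: y).

Definition strictly_convex_C1_norm (n : nat) (F : 'rV[R]_n -> R) : Prop :=
  (forall x, 0 <= F x) /\
  (forall x, F (- x) = F x) /\
  (forall (t : R) x, 0 < t -> F (t *: x) = t * F x) /\
  (forall x y (t : R), 0 <= t <= 1 ->
      F ((1 - t) *: x + t *: y) <= (1 - t) * F x + t * F y) /\
  (forall x, x != 0 -> 0 < F x) /\
  strictly_convex_set [set x | F x < 1] /\
  (forall x, x != 0 ->
     differentiable F x /\
     forall i : 'I_n, {for x, continuous (fun y => 'D_(evec i) F y)}).

Definition polar (n : nat) (F : 'rV[R]_n -> R) (eta : 'rV[R]_n) : R :=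
  sup [set dotp xi eta / F xi | xi in [set xi | xi != 0]].

Definition distF (n : nat) (F : 'rV[R]_n -> R) (Omega : set 'rV[R]_n)
    (x : 'rV[R]_n) : R :=
  inf [set polar F (x - y) | y in boundary Omega].

Definition rcons1 (n : nat) (x : R) (y : 'rV[R]_n) : 'rV[R]_(n.+1) :=
  row_mx (\row_(j < 1) x) y.

(* Lebesgue integral over R^n of a nonnegative extended-real function,
   computed as an iterated one-dimensional Lebesgue integral (Tonelli). *)
Fixpoint integralRn (n : nat) : ('rV[R]_n -> \bar R) -> \bar R :=
  match n with
  | 0 => fun f => f 0
  | m.+1 => fun f =>
      (\int[@lebesgue_measure R]_x integralRn (fun y => f (rcons1 x y)))%E
  end.

End Defs.

(* Main.v *)
(**
Write d for the anisotropic distance, beta = 1 - 1/p - alpha, and consider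
u = (d^beta |v|)^q and e = |v|^p / d + d^(p-1) F(grad v)^p, both extended by
zero. Since v has compact support in Omega, where d is positive and Lipschitz,
all integrands are continuous with compact support in R^n.

For s >= 0 and r >= 1 the function f = d^s |v|^r has slope along the axes at
most a constant times g = d^s |v|^(r-1) F(grad v) + d^(s-1) |v|^r, so the
Gagliardo-Nirenberg argument gives (int f^(n/(n-1)))^((n-1)/n) <= K int g.
Pointwise, g <= 2 e^(1-theta) u^theta when s = theta (1 + beta q) and
r = p + (q-p) theta with 0 <= theta <= 1 - 1/p.

If p (1-alpha) >= 1, the choice theta = beta / (1-alpha) makes f^(n/(n-1)) = u;
Hoelder then bounds int u by a power of int e times a power of int u that can
be absorbed. If p (1-alpha) < 1, theta = 0 bounds |v|^p in L^(n/(n-1)), and u is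
a geometric mean of |v|^(pn/(n-1)) and |v|^p / d.
*)
Require Import Defs.
From HB Require Import structures.
From mathcomp Require Import all_boot all_order all_algebra.
From mathcomp Require Import all_classical all_reals all_analysis.
From mathcomp Require Import measurable_realfun ring lra.
Set Implicit Arguments. Unset Strict Implicit. Unset Printing Implicit Defensive.
Import Order.TTheory GRing.Theory Num.Theory.
Import numFieldNormedType.Exports.
Local Open Scope classical_set_scope.
Local Open Scope ring_scope.

(** * Continuous compactly supported functions on the line *)

(** The distance is only Lipschitz, so d and f may fail to have partial derivatives. Only right-hand
    difference quotients along the axes are estimated, and a one-sided comparison argument
    integrates them. Apart from the exponents, the constants involved come from comparing [F] and
    its polar with the maximum norm, so they are fixed before the domain and v.

    The bound theta <= 1 - 1/p arises in the gradient term: its single factor F(grad v) costs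
    e^(1/p), and the rest of e^(1-theta) must be a nonnegative power of |v|^p / d. Matching
    f^(n/(n-1)) with u forces theta = 1 - 1/(p (1-alpha)), negative exactly when p (1-alpha) < 1.
    Then beta < 0 too, and |v|^p / d has to supply the negative power of d.

    Estimates are made on real-valued iterated integrals of continuous compactly supported
    functions, a class inherited by slices. Positive upper bounds [A], [B] stand in for the
    integrals, so vanishing integrals cause no degenerate powers or divisions. *)

Lemma half_gt0 (R : realType) (e : R) : 0 < e -> 0 < e / 2.
Proof. by move=> ?; rewrite divr_gt0. Qed.

Lemma continuous_pair (S T U : topologicalType) (f : S -> T) (g : S -> U) :
  continuous f -> continuous g -> continuous (fun x => (f x, g x)).
Proof.
by move=> fc gc x; apply: (@cvg_pair _ _ _ _ (nbhs (f x)) (nbhs (g x)));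
  [exact: fc|exact: gc].
Qed.

Section OneDim.
Variable R : realType.
Notation mu := (@lebesgue_measure R).
Implicit Types h g : R -> R.

Definition cc1 (h : R -> R) : Prop :=
  continuous h /\ exists M : R, forall x, M < `|x| -> h x = 0.

Lemma cc1_integrable h : cc1 h -> mu.-integrable setT (EFin \o h).
Proof.
move=> [hc [M hM]].
have -> : EFin \o h = (EFin \o h) \_ `[- M, M].
  apply/funext => x; rewrite /patch; case: ifPn => // xM /=.
  rewrite hM // ltNge; apply/negP => xM'.
  by move/negP: xM; apply; rewrite inE /= in_itv /= -ler_norml.
apply/(integrable_mkcond (mu := mu) (D := `[- M, M])) => //.
apply: continuous_compact_integrable; first exact: segment_compact.
exact: continuous_subspaceT.
Qed.

Lemma le_Rint_cc1 h g : cc1 h -> cc1 g -> (forall x, h x <= g x) ->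
  \int[mu]_x h x <= \int[mu]_x g x.
Proof.
by move=> hc gc hg; apply: le_Rintegral => //; exact: cc1_integrable.
Qed.

Lemma derivable_approx (V : normedModType R) (f : V -> R) (x w : V) :
  derivable f x w -> forall e, 0 < e ->
  exists2 r, 0 < r & forall t : R, `|t| < r ->
    `|f (x + t *: w) - f x - t * 'D_w f x| <= e * `|t|.
Proof.
move=> df e e0.
have : (t^-1 *: ((f \o shift x) (t *: w) - f x)) @[t --> 0^'] --> 'D_w f x.
  by rewrite /derive; exact: df.
move/cvgrPdist_lt => /(_ e e0) => /nbhs_ballP[r /= r0 rP].
exists r => // t tr; have [->|t0] := eqVneq t 0.
  by rewrite scale0r addr0 subrr mul0r subr0 normr0 mulr0.
have /rP /(_ t0) /= : ball (0 : R) r t by rewrite /ball /= sub0r normrN.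
move=> H; rewrite [x + _]addrC.
have -> : f (t *: w + x) - f x - t * 'D_w f x =
  - (t * ('D_w f x - t^-1 *: (f (t *: w + x) - f x))).
  rewrite mulrBr /GRing.scale /= mulrA divff // mul1r; ring.
by rewrite normrN normrM mulrC ler_wpM2r // ltW.
Qed.

(* [g] only has to bound the upper right Dini derivative of [h]. This is what
   makes the distance function usable without differentiating it. *)
Lemma le_int_upper_gradient h g (a b : R) : a <= b ->
  continuous h -> cc1 g -> (forall x, 0 <= g x) ->
  (forall c e, 0 < e ->
     \forall y \near c^'+, h y - h c <= (g c + e) * (y - c)) ->
  h b - h a <= \int[mu]_x g x.
Proof.
move=> ab hc gcc g0 slope.
have gi := cc1_integrable gcc.
have [gc _] := gcc.
(* The base point [a - 1] makes [a] an interior point, so that [G] is differentiable at [a] as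
   well. *)
pose G x := \int[mu]_(t in `[a - 1, x]) g t.
have giI (I : interval R) : mu.-integrable [set` I] (EFin \o g).
  by apply: integrableS gi => //.
have dG x : a <= x -> derivable G x 1 /\ G^`()%classic x = g x.
  move=> ax; apply: (@continuous_FTC1_closed _ g (a - 1) x (x + 1)) => //.
  - by rewrite ltrDl.
  - by rewrite (lt_le_trans _ ax)// gtrBl.
  - exact: gc.
have Gb : G b <= \int[mu]_x g x.
  rewrite /G Rintegral_mkcond; apply: le_Rintegral => //.
    by rewrite -restrict_EFin; apply/integrable_restrict => //=; rewrite setTI.
  by move=> x _; rewrite /patch; case: ifP.
have Ga : 0 <= G a by exact: Rintegral_ge0.
apply/ler_addgt0Pr => e e0.
pose e' := e / (2 * (b - a + 1)).
have ba0 : 0 < b - a + 1 by lra.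
have e'0 : 0 < e' by rewrite divr_gt0 // mulr_gt0.
(* The slack has slope [2 * e']: one [e'] pays for the Dini bound on [h], the other for the
   first-order expansion of [G]. *)
pose phi t := h t - h a - (G t - G a) - (2 * e') * (t - a).
suff : phi b <= 0.
  rewrite /phi => H.
  have : (2 * e') * (b - a) <= e.
    rewrite /e' (_ : 2 * _ * _ = e * ((b - a) / (b - a + 1))); last by field; lra.
    by rewrite ler_piMr ?(ltW e0)// ler_pdivrMr //; lra.
  by lra.
have phic x : a <= x -> {for x, continuous phi}.
  move=> ax; have [/derivable1_diffP/differentiable_continuous Gc _] := dG x ax.
  rewrite /phi; apply: cvgB; first apply: cvgB; first apply: cvgB.
  - exact: hc.
  - exact: cvg_cst.
  - by apply: cvgB => //; exact: cvg_cst.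
  - by apply: cvgM; [exact: cvg_cst|apply: cvgB; [exact: cvg_id|exact: cvg_cst]].
(* Continuous induction: [S] contains its supremum by continuity of [phi], and the slope bound would
   push [S] beyond a supremum smaller than [b]. *)
pose S := [set t | a <= t <= b /\ phi t <= 0].
have Sa : S a by split; [rewrite lexx | rewrite /phi; lra].
have hsS : has_sup S by split; [exists a | exists b => t [] /andP[]].
pose c := sup S.
have ac : a <= c by apply: ub_le_sup => //; case: hsS.
have cb : c <= b by apply: ge_sup => //; [exists a | move=> t [] /andP[]].
have phic0 : phi c <= 0.
  rewrite leNgt; apply/negP => pc.
  have /nbhs_ballP[r /= r0 rP] : \forall t \near c, 0 < phi t.
    exact: (cvgr_gt (phi c) (phic c ac)).
  have [t St ct] := sup_adherent r0 hsS.
  have tc : t <= c by apply: ub_le_sup => //; case: hsS.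
  have /rP : ball c r t by rewrite /ball /= ger0_norm ?subr_ge0 //; rewrite /c in tc ct *; lra.
  by rewrite ltNge; case: St => _ ->.
have [<-//|cb'] : c = b \/ c < b by apply/predU1P; rewrite -le_eqVlt.
have [Gd Gg] := dG c ac.
have : \forall t \near c^'+, S t /\ c < t.
  have := slope c e' e'0.
  have : \forall t \near c^'+, (g c - e') * (t - c) <= G t - G c.
    have [r r0 rP] := derivable_approx Gd e'0.
    near=> t; have ct : c < t by [].
    have : `|t - c| < r.
      rewrite ger0_norm ?subr_ge0 ?ltW // ltrBlDr addrC; near: t.
      by apply: nbhs_right_lt; rewrite ltrDl.
    move/rP; rewrite -derive1E Gg /GRing.scale /= mulr1 subrKC.
    rewrite (gtr0_norm (x := t - c)) ?subr_gt0 // ler_norml => /andP[+ _].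
    by rewrite mulrBl lerBrDl mulrC; lra.
  move=> H1 H2; near=> t; have tc : c < t by [].
  split => //; split.
    by apply/andP; split; [lra|apply: ltW; near: t; exact: nbhs_right_lt].
  have h1 : (g c - e') * (t - c) <= G t - G c by near: t.
  have h2 : h t - h c <= (g c + e') * (t - c) by near: t.
  move: phic0; rewrite /phi; move: h1 h2; nra.
move=> /(@filter_ex _ _ _ ) [t [St ct]].
have : t <= c by apply: ub_le_sup => //; case: hsS.
by rewrite leNgt ct.
Unshelve. all: by end_near.
Qed.

Lemma Rint_cc1_itv h (M : R) : (forall x, M < `|x| -> h x = 0) ->
  \int[mu]_x h x = \int[mu]_(x in `[- M, M]) h x.
Proof.
move=> hM; rewrite [RHS]Rintegral_mkcond; congr Rintegral; apply/funext => x.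
rewrite /patch; case: ifPn => // xM; apply: hM.
rewrite ltNge; apply/negP => xM'.
by move/negP: xM; apply; rewrite inE /= in_itv /= -ler_norml.
Qed.

(** Compactness of the segment makes continuity in the parameter uniform in [x]. The parameter space
    is arbitrary because it will collect the variables not yet integrated. *)
Lemma continuous_Rint_param (T : topologicalType) (h : T * R -> R) (M : R) :
  continuous h -> (forall t x, M < `|x| -> h (t, x) = 0) ->
  continuous (fun t => \int[mu]_x h (t, x)).
Proof.
move=> hc hM0 t0.
pose N := `|M|.
have hM t x : N < `|x| -> h (t, x) = 0.
  by move=> Nx; apply: hM0; apply: le_lt_trans Nx; exact: ler_norm.
have hct t : continuous (fun x => h (t, x)).
  move=> x; apply: (@continuous_comp _ _ _ (fun x => (t, x)) h).
    by apply: continuous_pair => ?; [exact: cvg_cst|exact: cvg_id].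
  exact: hc.
have hi t : mu.-integrable `[- N, N] (EFin \o (fun x => h (t, x))).
  apply: continuous_compact_integrable; first exact: segment_compact.
  exact/continuous_subspaceT/hct.
have E t : \int[mu]_x h (t, x) = \int[mu]_(x in `[- N, N]) h (t, x).
  by apply: Rint_cc1_itv => x; exact: hM.
rewrite (funext E).
apply/cvgrPdist_lt => e e0.
have N0 : 0 <= N by exact: normr_ge0.
pose e' := e / (2 * N + 1).
have e'0 : 0 < e' by rewrite divr_gt0 // ; lra.
have /compact_near_coveringP cov := @segment_compact R (- N) N.
have : \forall t \near t0, `[- N, N]%classic `<=`
    [set x | `|h (t0, x) - h (t, x)| < e'].
  apply: cov => x _.
  have /cvgrPdist_lt /(_ _ (half_gt0 e'0)) H1 := hc (t0, x).
  have /cvgrPdist_lt /(_ _ (half_gt0 e'0)) H2 := hct t0 x.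
  have {H1}[[A B] /= [At Bx] AB] := H1.
  exists (B `&` [set x' | `|h (t0, x) - h (t0, x')| < e' / 2], A) => /=.
    by split => //; exact: filterI.
  move=> [x' t] /= [[Bx' H] At']; have /= H' := AB (t, x') (conj At' Bx').
  by rewrite (le_lt_trans (ler_distD (h (t0, x)) _ _)) // (splitr e') ltrD // distrC.
move=> H; near=> t.
have Ht : `[- N, N]%classic `<=` [set x | `|h (t0, x) - h (t, x)| < e'] by near: t.
rewrite -RintegralB //.
have dc : continuous (fun x => h (t0, x) - h (t, x)).
  by move=> x; apply: cvgB; exact: hct.
have di : mu.-integrable `[- N, N] (EFin \o (fun x => h (t0, x) - h (t, x))).
  apply: continuous_compact_integrable; first exact: segment_compact.
  exact: continuous_subspaceT.
apply: le_lt_trans (le_normr_Rintegral _ di) _ => //.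
have ci : mu.-integrable `[- N, N] (EFin \o (fun x : R => e')).
  apply: continuous_compact_integrable; first exact: segment_compact.
  by apply: continuous_subspaceT => x; exact: cvg_cst.
have ni : mu.-integrable `[- N, N] (EFin \o (fun x => `|h (t0, x) - h (t, x)|)).
  apply: continuous_compact_integrable; first exact: segment_compact.
  by apply: continuous_subspaceT => x; apply: cvg_norm; exact: dc.
apply: le_lt_trans (le_Rintegral _ ni ci _) _ => //.
  by move=> x /Ht /ltW.
rewrite Rintegral_cst //= lebesgue_measure_itv /= lte_fin.
have eN : e' * (2 * N) < e.
  rewrite /e' mulrAC -mulrA gtr_pMr // ltr_pdivrMr; lra.
by case: ifP => _ /=; rewrite ?mulr0 // opprK; lra.
Unshelve. all: by end_near.
Qed.

(** Rational squares contained in [U] form a countable cover by measurable rectangles. This is what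
    makes continuous functions of two variables admissible in Tonelli's theorem. *)
Lemma open_measurable_prod (U : set (R * R)) : open U ->
  measurable (U : set (measurableTypeR R * measurableTypeR R)).
Proof.
move=> Uo.
pose F (p q r : rat) : set (measurableTypeR R * measurableTypeR R) :=
  if `[< ball (ratr p : R) (ratr r) `*` ball (ratr q : R) (ratr r) `<=` U >]
  then ball (ratr p : R) (ratr r) `*` ball (ratr q : R) (ratr r) else set0.
suff -> : U = \bigcup_p \bigcup_q \bigcup_r F p q r.
  apply: bigcupT_measurable_rat => p; apply: bigcupT_measurable_rat => q.
  apply: bigcupT_measurable_rat => r; rewrite /F; case: ifP => // _.
  by apply: measurableX; apply: open_measurable; exact: ball_open.
apply/seteqP; split => [[x y] Uxy|[x y] [p _ [q _ [r _]]]]; last first.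
  by rewrite /F; case: asboolP => // H; exact: H.
have [e e0 eU] : exists2 e, 0 < e & ball x e `*` ball y e `<=` U.
  have /nbhs_ballP[e /= e0 eU] : nbhs (x, y) U by move: Uo; rewrite openE; exact.
  by exists e => // z [z1 z2]; apply: eU; split.
(* A square of radius below [e / 2] whose centre is that close to the point stays within distance
   [e] of it. *)
have [r] := @rat_in_itvoo R 0 (e / 2) (half_gt0 e0).
rewrite in_itv /= => /andP[r0 re].
have [p] := @rat_in_itvoo R (x - ratr r) (x + ratr r) ltac:(lra).
rewrite in_itv /= => /andP[p1 p2].
have [q] := @rat_in_itvoo R (y - ratr r) (y + ratr r) ltac:(lra).
rewrite in_itv /= => /andP[q1 q2].
exists p => //; exists q => //; exists r => //; rewrite /F; case: asboolP.
  by move=> _; split; rewrite /ball /= ltr_distl; apply/andP; split; lra.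
case=> -[u w] [] /=; rewrite /ball /= !ltr_distl => /andP[u1 u2] /andP[w1 w2].
by apply: eU; split; rewrite /ball /= ltr_distl; apply/andP; split; lra.
Qed.

Lemma Rint_fubini (h : R * R -> R) (M : R) : continuous h ->
  (forall z, 0 <= h z) ->
  (forall x y, M < `|x| -> h (x, y) = 0) ->
  (forall x y, M < `|y| -> h (x, y) = 0) ->
  \int[mu]_x \int[mu]_y h (x, y) = \int[mu]_y \int[mu]_x h (x, y).
Proof.
move=> hc h0 hM1 hM2.
have mh : measurable_fun setT
    (h : measurableTypeR R * measurableTypeR R -> measurableTypeR R).
  apply: (measurability _ (RGenOpens.measurableE R)).
  move=> _ [_ [a [b ->] <-]]; rewrite setTI; apply: open_measurable_prod.
  by move/continuousP: hc; apply; exact: interval_open.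
have c1 x : cc1 (fun y => h (x, y)).
  split; last by exists M => y; exact: hM2.
  move=> y; apply: (@continuous_comp _ _ _ (fun y => (x, y)) h).
    by apply: continuous_pair => ?; [exact: cvg_cst|exact: cvg_id].
  exact: hc.
have c2 y : cc1 (fun x => h (x, y)).
  split; last by exists M => x; exact: hM1.
  move=> x; apply: (@continuous_comp _ _ _ (fun x => (x, y)) h).
    by apply: continuous_pair => ?; [exact: cvg_id|exact: cvg_cst].
  exact: hc.
have H := @fubini_tonelli _ _ _ _ R mu mu (EFin \o h)
  ltac:(exact/measurable_EFinP) ltac:(by move=> z; rewrite lee_fin).
rewrite /Rintegral; congr fine.
transitivity (\int[mu]_x \int[mu]_y (EFin \o h) (x, y))%E.
  apply: eq_integral => x _; rewrite fineK //.
  by apply: integrable_fin_num => //; exact: cc1_integrable.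
rewrite H; apply: eq_integral => y _; rewrite fineK //.
by apply: integrable_fin_num => //; exact: cc1_integrable.
Qed.

End OneDim.

(** * Iterated integrals of continuous compactly supported functions *)

Section Iterated.
Variable R : realType.
Notation mu := (@lebesgue_measure R).

(** The cube condition is stated coordinate by coordinate, so that slices inherit it with the same
    [M]; it is vacuous in dimension zero. *)
Definition cc n (f : 'rV[R]_n -> R) : Prop :=
  continuous f /\ exists M : R, forall (x : 'rV[R]_n) i, M < `|x 0 i| -> f x = 0.

(** Real-valued counterpart of [integralRn]. Each [Rintegral] takes a finite part, which is harmless
    on [cc] functions, where all inner integrals are finite. *)
Fixpoint intRn n : ('rV[R]_n -> R) -> R :=
  match n with
  | 0 => fun f => f 0
  | m.+1 => fun f => \int[mu]_x intRn (fun y => f (rcons1 x y))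
  end.

Lemma rcons1_0 n (x : R) (y : 'rV[R]_n) : rcons1 x y 0 ord0 = x.
Proof.
rewrite /rcons1 (_ : ord0 = lshift n (ord0 : 'I_1)); last exact: val_inj.
exact: etrans (row_mxEl _ _ _ _) (mxE _ _ _ _).
Qed.

Lemma rcons1_S n (x : R) (y : 'rV[R]_n) i : rcons1 x y 0 (lift ord0 i) = y 0 i.
Proof.
rewrite /rcons1 (_ : lift ord0 i = rshift 1 i); last exact: val_inj.
exact: row_mxEr.
Qed.

Lemma row_continuous (T : topologicalType) n (f : T -> 'rV[R]_n) :
  (forall i, continuous (fun t => f t 0 i)) -> continuous f.
Proof.
move=> fc t; apply/cvgrPdist_lt => e e0.
have H : \forall u \near t, forall i, `|f t 0 i - f u 0 i| < e.
  by apply: filter_forall => i; have /cvgrPdist_lt := fc i t; exact.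
near=> u; have Hu : forall i, `|f t 0 i - f u 0 i| < e by near: u.
rewrite -[ltLHS]/(mx_norm _) mx_normrE; apply/bigmax_ltP; split => // -[i j] _ /=.
by rewrite !mxE ord1.
Unshelve. all: by end_near. Qed.

Lemma continuous_rcons1 (T : topologicalType) n (f : T -> R) (g : T -> 'rV[R]_n) :
  continuous f -> continuous g -> continuous (fun t => rcons1 (f t) (g t)).
Proof.
move=> fc gc; apply: row_continuous => i.
have [->|[j ->]] : i = ord0 \/ exists j, i = lift ord0 j.
- by case: (unliftP ord0 i) => [j|] ->; [right; exists j|left].
- by under eq_fun do rewrite rcons1_0.
under eq_fun do rewrite rcons1_S.
move=> t; apply: (@continuous_comp _ _ _ g (fun v : 'rV[R]_n => v 0 j)).
  exact: gc.
exact: coord_continuous.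
Qed.

Lemma intRn_ext n (f g : 'rV[R]_n -> R) : f =1 g -> intRn f = intRn g.
Proof. by move=> /funext ->. Qed.

Lemma intRn0 n : intRn (fun _ : 'rV[R]_n => 0) = 0.
Proof.
elim: n => //= n IH; rewrite IH /Rintegral; apply/eqP.
by rewrite (integral_cst mu measurableT) mul0e.
Qed.

(** The induction moves the first integration variable into the parameter, replacing [T] by [T * R];
    hence the generalization over [T]. *)
Lemma continuous_intRn_param n (T : topologicalType) (g : T * 'rV[R]_n -> R) (M : R) :
  continuous g -> (forall t (y : 'rV[R]_n) i, M < `|y 0 i| -> g (t, y) = 0) ->
  continuous (fun t => intRn (fun y => g (t, y))).
Proof.
elim: n T g => [|n IH] T g gc gM /=.
  move=> t; apply: (@continuous_comp T (T * 'rV[R]_0)%type R (fun t => (t, 0)) g); last exact: gc.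
  by apply: continuous_pair => ?; [exact: cvg_id|exact: cst_continuous].
apply: (@continuous_Rint_param R T
  (fun z => intRn (fun y => g (z.1, rcons1 z.2 y))) M) => [|t x xM].
  apply: (IH _ (fun z => g (z.1.1, rcons1 z.1.2 z.2))) => [|z y i yM].
    move=> z; apply: (@continuous_comp _ _ _
      (fun z => (z.1.1, rcons1 z.1.2 z.2)) g); last exact: gc.
    apply: continuous_pair.
      by move=> ?; apply: (@continuous_comp _ _ _ fst fst); exact: cvg_fst.
    apply: continuous_rcons1; last by move=> ?; exact: cvg_snd.
    by move=> u; apply: (@continuous_comp _ _ _ fst snd);
      [exact: cvg_fst|exact: cvg_snd].
  by apply: (gM _ _ (lift ord0 i)); rewrite rcons1_S.
rewrite /= -[RHS](intRn0 n); apply: intRn_ext => y.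
by apply: (gM _ _ ord0); rewrite rcons1_0.
Qed.

Lemma cc_slice n (f : 'rV[R]_n.+1 -> R) x :
  cc f -> cc (fun y => f (rcons1 x y)).
Proof.
move=> [fc [M fM]]; split.
  move=> y; apply: (@continuous_comp _ _ _ (rcons1 x) f); last exact: fc.
  by apply: continuous_rcons1 => ?; [exact: cst_continuous|exact: cvg_id].
by exists M => y i yM; apply: (fM _ (lift ord0 i)); rewrite rcons1_S.
Qed.

Lemma cc1_intRn n (f : 'rV[R]_n.+1 -> R) :
  cc f -> cc1 (fun x => intRn (fun y => f (rcons1 x y))).
Proof.
move=> [fc [M fM]]; split.
  apply: (@continuous_intRn_param n R (fun z => f (rcons1 z.1 z.2)) M).
    move=> z; apply: (@continuous_comp _ _ _ (fun z => rcons1 z.1 z.2) f);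
      last exact: fc.
    by apply: continuous_rcons1 => ?; [exact: cvg_fst|exact: cvg_snd].
  by move=> t y i yM; apply: (fM _ (lift ord0 i)); rewrite rcons1_S.
exists M => x xM; rewrite -[RHS](intRn0 n); apply: intRn_ext => y.
by apply: (fM _ ord0); rewrite rcons1_0.
Qed.

Lemma integralRnE n (f : 'rV[R]_n -> R) : cc f ->
  integralRn (fun x => (f x)%:E) = (intRn f)%:E.
Proof.
elim: n f => //= n IH f fcc.
under eq_integral do rewrite (IH _ (cc_slice _ fcc)).
rewrite /Rintegral fineK //; apply: integrable_fin_num => //.
exact/cc1_integrable/cc1_intRn.
Qed.

Lemma le_intRn n (f g : 'rV[R]_n -> R) : cc f -> cc g -> (forall x, f x <= g x) ->
  intRn f <= intRn g.
Proof.
elim: n f g => //= n IH f g fcc gcc fg.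
apply: le_Rint_cc1; [exact: cc1_intRn|exact: cc1_intRn|move=> x].
by apply: IH => //; exact: cc_slice.
Qed.

Lemma cc0 n : cc (fun _ : 'rV[R]_n => 0).
Proof. by split; [move=> ?; exact: cst_continuous|exists 0]. Qed.

Lemma intRn_ge0 n (f : 'rV[R]_n -> R) : cc f -> (forall x, 0 <= f x) -> 0 <= intRn f.
Proof. by move=> fcc f0; rewrite -(intRn0 n); apply: le_intRn => //; exact: cc0. Qed.

Lemma ccD n (f g : 'rV[R]_n -> R) : cc f -> cc g -> cc (fun x => f x + g x).
Proof.
move=> [fc [M fM]] [gc [N gN]]; split.
  by move=> x; exact: (cvgD (fc x) (gc x)).
by exists (Num.max M N) => x i; rewrite gt_max => /andP[h1 h2];
  rewrite (fM _ _ h1) (gN _ _ h2) addr0.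
Qed.

Lemma ccZ n (a : R) (f : 'rV[R]_n -> R) : cc f -> cc (fun x => a * f x).
Proof.
move=> [fc [M fM]]; split.
  by move=> x; exact: (cvgM (cvg_cst a) (fc x)).
by exists M => x i /fM ->; rewrite mulr0.
Qed.

Lemma intRnD n (f g : 'rV[R]_n -> R) : cc f -> cc g ->
  intRn (fun x => f x + g x) = intRn f + intRn g.
Proof.
elim: n f g => //= n IH f g fcc gcc.
under eq_Rintegral do rewrite (IH _ _ (cc_slice _ fcc) (cc_slice _ gcc)).
by rewrite RintegralD //; apply: cc1_integrable; exact: cc1_intRn.
Qed.

Lemma intRnZ n a (f : 'rV[R]_n -> R) : cc f -> intRn (fun x => a * f x) = a * intRn f.
Proof.
elim: n f => //= n IH f fcc.
under eq_Rintegral do rewrite (IH _ (cc_slice _ fcc)).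
by rewrite RintegralZl //; apply: cc1_integrable; exact: cc1_intRn.
Qed.

(** The extra variable passes the iterated integrals one at a time, each exchange being the planar
    case. *)
Lemma intRn_fubini n (h : R * 'rV[R]_n -> R) (M : R) :
  continuous h -> (forall z, 0 <= h z) ->
  (forall x y, M < `|x| -> h (x, y) = 0) ->
  (forall x (y : 'rV[R]_n) i, M < `|y 0 i| -> h (x, y) = 0) ->
  intRn (fun y => \int[mu]_x h (x, y)) = \int[mu]_x intRn (fun y => h (x, y)).
Proof.
elim: n h => //= n IH h hc h0 hM1 hM2.
have hcc x t : cc (fun y => h (x, rcons1 t y)).
  split; last by exists M => y i yM; apply: (hM2 _ _ (lift ord0 i)); rewrite rcons1_S.
  move=> y; apply: (@continuous_comp _ _ _ (fun y => (x, rcons1 t y)) h); last exact: hc.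
  apply: continuous_pair; first by move=> ?; exact: cst_continuous.
  by apply: continuous_rcons1 => ?; [exact: cst_continuous|exact: cvg_id].
transitivity (\int[mu]_t \int[mu]_x intRn (fun y => h (x, rcons1 t y))).
  apply: eq_Rintegral => t _; apply: (IH (fun z => h (z.1, rcons1 t z.2))) => //.
  - move=> z; apply: (@continuous_comp _ _ _ (fun z => (z.1, rcons1 t z.2)) h); last exact: hc.
    apply: continuous_pair; first by move=> ?; exact: cvg_fst.
    by apply: continuous_rcons1 => ?; [exact: cst_continuous|exact: cvg_snd].
  - by move=> x y xM; exact: hM1.
  - by move=> x y i yM; apply: (hM2 _ _ (lift ord0 i)); rewrite rcons1_S.
apply/esym.
apply: (@Rint_fubini R (fun z => intRn (fun y => h (z.1, rcons1 z.2 y))) M).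
- apply: (@continuous_intRn_param n (R * R)%type
    (fun w => h (w.1.1, rcons1 w.1.2 w.2)) M).
    move=> z; apply: (@continuous_comp _ _ _
      (fun z => (z.1.1, rcons1 z.1.2 z.2)) h); last exact: hc.
    apply: continuous_pair.
      by move=> ?; apply: (@continuous_comp _ _ _ fst fst); exact: cvg_fst.
    apply: continuous_rcons1; last by move=> ?; exact: cvg_snd.
    by move=> u; apply: (@continuous_comp _ _ _ fst snd);
      [exact: cvg_fst|exact: cvg_snd].
  by move=> t y i yM; apply: (hM2 _ _ (lift ord0 i)); rewrite rcons1_S.
- by move=> z; apply: intRn_ge0.
- move=> x y xM; rewrite /= -[RHS](intRn0 n); apply: intRn_ext => w; exact: hM1.
- move=> x y xM; rewrite /= -[RHS](intRn0 n); apply: intRn_ext => w.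
  by apply: (hM2 _ _ ord0); rewrite rcons1_0.
Qed.

Lemma cc_Rint n (f : 'rV[R]_n.+1 -> R) :
  cc f -> cc (fun y => \int[mu]_x f (rcons1 x y)).
Proof.
move=> [fc [M fM]]; split.
  apply: (@continuous_Rint_param R _ (fun z => f (rcons1 z.2 z.1)) M).
    move=> z; apply: (@continuous_comp _ _ _ (fun z => rcons1 z.2 z.1) f);
      last exact: fc.
    by apply: continuous_rcons1 => ?; [exact: cvg_snd|exact: cvg_fst].
  by move=> t x xM; apply: (fM _ ord0); rewrite rcons1_0.
exists M => y i yM; rewrite /Rintegral.
under eq_integral do rewrite (fM _ (lift ord0 i)) ?rcons1_S //.
by rewrite (integral_cst mu measurableT) mul0e.
Qed.

(** Needed because integrating out the first axis yields a function of the other variables whose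
    mass must be that of [f]. *)
Lemma intRn_Rint n (f : 'rV[R]_n.+1 -> R) : cc f -> (forall x, 0 <= f x) ->
  intRn (fun y => \int[mu]_x f (rcons1 x y)) = intRn f.
Proof.
move=> [fc [M fM]] f0.
apply: (@intRn_fubini n (fun z => f (rcons1 z.1 z.2)) M) => //.
- move=> z; apply: (@continuous_comp _ _ _ (fun z => rcons1 z.1 z.2) f);
    last exact: fc.
  by apply: continuous_rcons1 => ?; [exact: cvg_fst|exact: cvg_snd].
- by move=> x y xM; apply: (fM _ ord0); rewrite rcons1_0.
- by move=> x y i yM; apply: (fM _ (lift ord0 i)); rewrite rcons1_S.
Qed.

Lemma powR_amgm (a b t : R) : 0 <= a -> 0 <= b -> 0 <= t < 1 ->
  a `^ (1 - t) * b `^ t <= (1 - t) * a + t * b.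
Proof.
(* The case [t = 0] is set apart because Young's inequality is used with exponents [(1 - t)^-1] and
   [t^-1]. *)
move=> a0 b0 /andP[]; rewrite le_eqVlt => /predU1P[<- _|t0 t1].
  by rewrite subr0 powRr0 powRr1 // mulr1 mul1r mul0r addr0.
have s0 : 0 < 1 - t by rewrite subr_gt0.
have := @conjugate_powR R (a `^ (1 - t)) (b `^ t) (1 - t)^-1 t^-1
  (powR_ge0 _ _) (powR_ge0 _ _).
rewrite !invr_gt0 !invrK -!powRrM !divff ?gt_eqF // !powRr1 //.
by rewrite [a * _]mulrC [b * _]mulrC; apply => //; rewrite subrK.
Qed.

(** Weighted AM-GM applied to [f / A] and [g / B] turns the product into a linear combination, so
    only linearity and monotonicity of the integral are used. *)
Lemma intRn_hoelder n (f g h : 'rV[R]_n -> R) (t A B : R) : 0 <= t < 1 ->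
  cc f -> cc g -> cc h -> (forall x, 0 <= f x) -> (forall x, 0 <= g x) ->
  (forall x, h x <= f x `^ (1 - t) * g x `^ t) ->
  0 < A -> 0 < B -> intRn f <= A -> intRn g <= B ->
  intRn h <= A `^ (1 - t) * B `^ t.
Proof.
move=> t01 fcc gcc hcc f0 g0 hfg A0 B0 fA gB.
have /andP[t0 t1] := t01.
pose C := A `^ (1 - t) * B `^ t.
have C0 : 0 < C by rewrite mulr_gt0 // powR_gt0.
have H x : h x <= C * (1 - t) / A * f x + C * t / B * g x.
  apply: le_trans (hfg x) _.
  have fx : f x = A * (f x / A) by rewrite mulrC divfK ?gt_eqF.
  have gx : g x = B * (g x / B) by rewrite mulrC divfK ?gt_eqF.
  have fA0 : 0 <= f x / A by rewrite divr_ge0 // ltW.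
  have gB0 : 0 <= g x / B by rewrite divr_ge0 // ltW.
  rewrite {1}fx {1}gx [X in X * _ <= _]powRM ?(ltW A0) //.
  rewrite [X in _ * X <= _]powRM ?(ltW B0) // mulrACA -/C.
  apply: le_trans (ler_wpM2l (ltW C0) (powR_amgm fA0 gB0 t01)) _.
  suff -> : C * ((1 - t) * (f x / A) + t * (g x / B)) =
    C * (1 - t) / A * f x + C * t / B * g x by [].
  by ring.
apply: le_trans (le_intRn hcc _ H) _; first by apply: ccD; exact: ccZ.
rewrite intRnD ?intRnZ //; try exact: ccZ.
apply: (@le_trans _ _ (C * (1 - t) / A * A + C * t / B * B)).
  have C1 : 0 <= C * (1 - t) / A.
    by rewrite divr_ge0 ?(ltW A0) // mulr_ge0 ?(ltW C0) // subr_ge0 ltW.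
  have C2 : 0 <= C * t / B by rewrite divr_ge0 ?(ltW B0) // mulr_ge0 ?(ltW C0).
  exact: lerD (ler_wpM2l C1 fA) (ler_wpM2l C2 gB).
by rewrite !divfK ?gt_eqF // -mulrDr subrK mulr1.
Qed.

End Iterated.

(** * The Gagliardo-Nirenberg inequality *)

Section GagliardoNirenberg.
Variable R : realType.
Notation mu := (@lebesgue_measure R).

Lemma continuous_powR_gt0 (a r : R) : 0 < a -> {for a, continuous (@powR R ^~ r)}.
Proof.
move=> a0; apply/differentiable_continuous/derivable1_diffP.
by apply: derivable_powR; rewrite in_itv /= a0.
Qed.

Lemma continuous_norm_powR (r : R) : 0 <= r -> continuous (fun x : R => `|x| `^ r).
Proof.
(* With the convention that zero to the power zero is 1, the exponent 0 gives a constant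
   function. *)
rewrite le_eqVlt => /predU1P[<- x|r0 x].
  rewrite (_ : (fun _ => _) = fun _ : R => 1 : R); first exact: cst_continuous.
  by apply/funext => y; rewrite powRr0.
have [->|x0] := eqVneq x 0; last first.
  apply: (@continuous_comp R R R (fun x => `|x|) (@powR R ^~ r)).
    exact: norm_continuous.
  by apply: continuous_powR_gt0; rewrite normr_gt0.
apply/cvgrPdist_lt => e e0; rewrite normr0 powR0 ?gt_eqF //.
near=> y; rewrite sub0r normrN ger0_norm ?powR_ge0 //.
have : `|y| < e `^ r^-1.
  near: y; apply/nbhs_ballP; exists (e `^ r^-1) => /=; first exact: powR_gt0.
  by move=> y; rewrite /ball /= sub0r normrN.
have H1 : `|y| \in Num.nneg by rewrite nnegrE.
have H2 : e `^ r^-1 \in Num.nneg by rewrite nnegrE powR_ge0.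
move=> /(gt0_ltr_powR r0 H1 H2) /=.
by rewrite -[(e `^ _) `^ _]powRrM mulVf ?gt_eqF // powRr1 // ltW.
Unshelve. all: by end_near. Qed.

Lemma continuous_powR_nonneg (T : topologicalType) (f : T -> R) (r : R) x :
  0 <= r -> (forall x, 0 <= f x) -> {for x, continuous f} ->
  {for x, continuous (fun x => f x `^ r)}.
Proof.
move=> r0 f0 fc.
have -> : (fun x => f x `^ r) = (fun y => `|y| `^ r) \o f.
  by apply/funext => y /=; rewrite ger0_norm.
by apply: continuous_comp => //; exact: continuous_norm_powR.
Qed.

Lemma cc_powR n (f : 'rV[R]_n -> R) (r : R) : 0 < r -> (forall x, 0 <= f x) ->
  cc f -> cc (fun x => f x `^ r).
Proof.
move=> r0 f0 [fc [M fM]]; split.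
  by move=> x; apply: continuous_powR_nonneg => //; [exact: ltW|exact: fc].
by exists M => x i /fM ->; rewrite powR0 ?gt_eqF.
Qed.

Lemma ccM n (f g : 'rV[R]_n -> R) : cc f -> continuous g ->
  cc (fun x => f x * g x).
Proof.
move=> [fc [M fM]] gc; split; first by move=> x; exact: (cvgM (fc x) (gc x)).
by exists M => x i /fM ->; rewrite mul0r.
Qed.

Definition upd n (i : 'I_n) (t : R) (x : 'rV[R]_n) : 'rV[R]_n :=
  \row_j (if j == i then t else x 0 j).

Lemma upd_rcons1_0 n (t x : R) (y : 'rV[R]_n) :
  upd ord0 t (rcons1 x y) = rcons1 t y.
Proof.
apply/rowP => j; rewrite mxE; case: (unliftP ord0 j) => [k|] ->.
  by rewrite !rcons1_S.
by rewrite eqxx rcons1_0.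
Qed.

Lemma upd_rcons1_S n (t x : R) (y : 'rV[R]_n) i :
  upd (lift ord0 i) t (rcons1 x y) = rcons1 x (upd i t y).
Proof.
apply/rowP => j; rewrite mxE; case: (unliftP ord0 j) => [k|] ->.
  by rewrite !rcons1_S mxE (inj_eq (@lift_inj _ ord0)).
by rewrite !rcons1_0.
Qed.

(** All that Gagliardo-Nirenberg needs to know about derivatives: the fundamental theorem of
    calculus along the axis-parallel lines through [x]. *)
Definition line_dominated n (f g : 'rV[R]_n -> R) : Prop :=
  forall i x, f x <= \int[mu]_t g (upd i t x).

(* The inequality dual to the Sobolev embedding: unlike the embedding itself, it
   makes sense in dimension one, where the induction starts. *)
Definition GN_dual n : Prop :=
  forall (f g : 'rV[R]_n.+1 -> R) (A : R),
    cc f -> cc g -> (forall x, 0 <= f x) -> (forall x, 0 <= g x) ->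
    0 < A -> intRn g <= A -> line_dominated f g ->
  forall (phi : 'rV[R]_n.+1 -> R) (B : R),
    cc phi -> (forall x, 0 <= phi x) -> 0 < B -> intRn phi <= B ->
    intRn (fun x => f x * phi x `^ n.+1%:R^-1) <= A * B `^ n.+1%:R^-1.

(** Nonnegative exponents let [x] be 0: opposite nonzero exponents would give 1 on the left and 0 on
    the right. *)
Lemma powR_split (x a b : R) : 0 <= x -> 0 <= a -> 0 <= b ->
  x `^ (a + b) = x `^ a * x `^ b.
Proof.
move=> x0 a0 b0; have [ab|ab] := eqVneq (a + b) 0; last by rewrite powRD ?(negbTE ab).
have -> : a = 0 by lra.
have -> : b = 0 by lra.
by rewrite addr0 powRr0 mulr1.
Qed.

(* On each slice, [f] is bounded by the integral of [g] along the first axis,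
   which is used for the exponent [1 / (n + 1)] of [f]; the dual inequality in
   the remaining variables controls the other factor. *)
Lemma GN_of_dual n : GN_dual n ->
  forall (f g : 'rV[R]_n.+2 -> R) (A : R),
    cc f -> cc g -> (forall x, 0 <= f x) -> (forall x, 0 <= g x) ->
    0 < A -> intRn g <= A -> line_dominated f g ->
    intRn (fun x => f x `^ (1 + n.+1%:R^-1)) <= A `^ (1 + n.+1%:R^-1).
Proof.
move=> dual f g A fcc gcc f0 g0 A0 gA fg.
(* With N = n + 2 the ambient dimension, [1 + c] is the exponent N / (N - 1). *)
set c := n.+1%:R^-1; have c0 : 0 < c :> R by rewrite invr_gt0.
pose phi y := \int[mu]_x g (rcons1 x y).
have phicc : cc phi by exact: cc_Rint.
have phi0 y : 0 <= phi y by exact: Rintegral_ge0.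
have phiA : intRn phi <= A by rewrite /phi intRn_Rint.
have fphi x y : f (rcons1 x y) <= phi y.
  apply: le_trans (fg ord0 _) _.
  by under eq_Rintegral do rewrite upd_rcons1_0.
pose gam x := intRn (fun y => g (rcons1 x y)).
have fecc : cc (fun x => f x `^ (1 + c)) by apply: cc_powR => //; lra.
have slice x : intRn (fun y => f (rcons1 x y) `^ (1 + c)) <= A `^ c * gam x.
  apply: (@le_trans _ _ (intRn (fun y => f (rcons1 x y) * phi y `^ c))).
    apply: le_intRn.
    - exact: (cc_slice x fecc).
    - apply: ccM; first exact: cc_slice.
      move=> y; apply: continuous_powR_nonneg => //; first exact: ltW.
      exact: (proj1 phicc y).
    - move=> y; rewrite powR_split // ?(ltW c0) // powRr1 //.
      by apply: ler_wpM2l => //; apply: ge0_ler_powR; rewrite ?nnegrE ?(ltW c0).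
  have Ac : 0 < A `^ c by exact: powR_gt0.
  apply/ler_addgt0Pr => e e0.
  have ec0 : 0 < e / A `^ c by rewrite divr_gt0.
  have gam0 : 0 <= gam x by apply: intRn_ge0 => //; exact: cc_slice.
  have := @dual (fun y => f (rcons1 x y)) (fun y => g (rcons1 x y))
    (gam x + e / A `^ c) (cc_slice x fcc) (cc_slice x gcc).
  move=> /(_ (fun _ => f0 _) (fun _ => g0 _) (ltr_wpDl gam0 ec0)).
  have le1 : gam x <= gam x + e / A `^ c by rewrite lerDl ltW.
  move=> /(_ le1); have ld : line_dominated (fun y => f (rcons1 x y))
      (fun y => g (rcons1 x y)).
    move=> i y; apply: le_trans (fg (lift ord0 i) _) _.
    by under eq_Rintegral do rewrite upd_rcons1_S.
  move=> /(_ ld phi A phicc phi0 A0 phiA) /le_trans; apply.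
  by rewrite mulrDl divfK ?gt_eqF // mulrC.
apply: (@le_trans _ _ (A `^ c * intRn g)).
  rewrite -(@intRnZ _ _ _ _ gcc).
  apply: le_Rint_cc1; [exact: (cc1_intRn fecc)|exact: (cc1_intRn (ccZ (A `^ c) gcc))|].
  by move=> x; apply: le_trans (slice x) _; rewrite -(intRnZ (A `^ c) (cc_slice x gcc)).
rewrite powR_split ?(ltW A0) ?(ltW c0) // powRr1 ?(ltW A0) // mulrC.
by apply: ler_wpM2r => //; exact: powR_ge0.
Qed.

(** The dual inequality in one dimension yields the embedding in the next, and Hoelder against [phi]
    turns that embedding into the dual inequality there. *)
Lemma GN_dual_holds n : GN_dual n.
Proof.
elim: n => [|n IH] f g A fcc gcc f0 g0 A0 gA fg phi B phicc phi0 B0 phiB.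
  (* In dimension one the only line is the whole space, so line domination is a uniform bound. *)
  have fA x : f x <= A.
    apply: le_trans (fg ord0 x) _; apply: le_trans gA.
    rewrite le_eqVlt; apply/orP; left; apply/eqP => /=.
    apply: eq_Rintegral => t _; congr g.
    apply/rowP => j; have -> : j = ord0 by apply: val_inj; rewrite ord1.
    by rewrite mxE eqxx rcons1_0.
  rewrite invr1 powRr1 ?(ltW B0) //.
  under intRn_ext do rewrite powRr1 //.
  apply: le_trans (_ : A * intRn phi <= _); last by rewrite ler_pM2l.
  rewrite -intRnZ //; apply: le_intRn.
  - by apply: ccM => //; case: phicc.
  - exact: ccZ.
  - by move=> x; rewrite ler_wpM2r.
have H := GN_of_dual IH fcc gcc f0 g0 A0 gA fg.
set e : R := 1 + n.+1%:R^-1 in H.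
have n0 : 0 < n.+1%:R :> R by [].
have n1 : 0 < n.+2%:R :> R by [].
have e0 : 0 < e by rewrite /e ltr_wpDr // invr_ge0.
set t : R := n.+2%:R^-1.
have te : 1 - t = e^-1.
  rewrite /e /t -natr1; move: n0; set m : R := n.+1%:R => m0; field.
  by apply/andP; split; rewrite gt_eqF //; lra.
have t01 : 0 <= t < 1.
  by rewrite invr_ge0 ltW //= invf_lt1 // ltr1n.
apply: le_trans (@intRn_hoelder _ _ (fun x => f x `^ e) phi _ t (A `^ e) B t01
  _ _ _ _ _ _ _ _ _ _) _ => //.
- exact: cc_powR.
- apply: ccM => // x; apply: continuous_powR_nonneg => //.
  + by rewrite invr_ge0.
  + exact: (proj1 phicc x).
- by move=> x; exact: powR_ge0.
- by move=> x; rewrite te -powRrM divff ?gt_eqF // powRr1.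
- exact: powR_gt0.
- by rewrite te -powRrM divff ?gt_eqF // powRr1 ?(ltW A0).
Qed.

Lemma gagliardo_nirenberg n (f g : 'rV[R]_n.+2 -> R) (A : R) :
    cc f -> cc g -> (forall x, 0 <= f x) -> (forall x, 0 <= g x) ->
    0 < A -> intRn g <= A -> line_dominated f g ->
    intRn (fun x => f x `^ (1 + n.+1%:R^-1)) <= A `^ (1 + n.+1%:R^-1).
Proof. exact/GN_of_dual/GN_dual_holds. Qed.

End GagliardoNirenberg.

(** * The norm, its polar and the anisotropic distance *)

Section Norm.
Variables (R : realType) (n : nat) (F : 'rV[R]_n -> R).
Hypothesis hF : strictly_convex_C1_norm F.
Implicit Types x y z eta xi : 'rV[R]_n.

Lemma coord_le_norm x i : `|x 0 i| <= `|x|.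
Proof.
rewrite -[leRHS]/(mx_norm _) mx_normrE; apply/bigmax_geP; right => /=.
by exists (0, i).
Qed.

Lemma norm_coord x : (0 < n)%N -> exists i, `|x| = `|x 0 i|.
Proof.
move=> n0; have [x0|/mx_norm_neq0[[i j] /= H]] := eqVneq (mx_norm x) 0; last first.
  by exists j; rewrite -[LHS]/(mx_norm x) H (ord1 i).
by exists (Ordinal n0); rewrite (mx_norm_eq0 x0) mxE normr0 normr0.
Qed.

Lemma Fge0 x : 0 <= F x. Proof. by case: hF. Qed.

Lemma FZ_gt0 (t : R) x : 0 < t -> F (t *: x) = t * F x.
Proof. by move: t x; case: hF => _ [_ [? _]]. Qed.

Lemma F_0 : F 0 = 0.
Proof. by have := @FZ_gt0 2 0 ltac:(by []); rewrite scaler0; lra. Qed.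

Lemma FZ (t : R) x : F (t *: x) = `|t| * F x.
Proof.
have [t0|t0|->] := ltgtP t 0; last by rewrite scale0r F_0 normr0 mul0r.
  have [_ [FN _]] := hF.
  by rewrite ltr0_norm // -FN -scaleNr FZ_gt0 // oppr_gt0.
by rewrite gtr0_norm // FZ_gt0.
Qed.

Lemma Fgt0 x : x != 0 -> 0 < F x.
Proof. by move: x; case: hF => _ [_ [_ [_ [? _]]]]. Qed.

Lemma FD x y : F (x + y) <= F x + F y.
Proof.
have [_ [_ [_ [Fcvx _]]]] := hF.
have := Fcvx (2 *: x) (2 *: y) 2^-1 ltac:(lra).
have -> : 1 - 2^-1 = 2^-1 :> R by lra.
by rewrite !scalerA mulVf // !scale1r !FZ_gt0 // !mulrA mulVf // !mul1r.
Qed.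

(** Comparison constant with [|x|], the maximum norm, from expanding in the canonical basis. The
    leading 1 keeps it positive even in dimension zero. *)
Definition Fbound : R := 1 + \sum_(i < n) F (evec R i).

Lemma Fbound_gt0 : 0 < Fbound.
Proof. by rewrite ltr_pwDl // sumr_ge0 // => i _; exact: Fge0. Qed.

Lemma F_sum (I : Type) (r : seq I) (f : I -> 'rV[R]_n) :
  F (\sum_(i <- r) f i) <= \sum_(i <- r) F (f i).
Proof.
elim: r => [|i r IH]; first by rewrite !big_nil F_0.
by rewrite !big_cons; apply: le_trans (FD _ _) _; rewrite lerD2l.
Qed.

Lemma F_le x : F x <= Fbound * `|x|.
Proof.
rewrite {1}(row_sum_delta x); apply: le_trans (F_sum _ _) _.
rewrite mulrDl mul1r ler_wpDl // mulr_suml; apply: ler_sum => i _.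
by rewrite FZ mulrC ler_wpM2l ?Fge0 // coord_le_norm.
Qed.

Lemma F_continuous : continuous F.
Proof.
move=> x; apply/(@cvgrPdist_lt _ _ _ (nbhs x) (nbhs_filter x) F (F x)) => e e0.
have B0 := Fbound_gt0.
have r0 : 0 < e / Fbound by rewrite divr_gt0.
have H : \forall y \near x, `|x - y| < e / Fbound.
  apply/nbhs_ballP; exists (e / Fbound) => //= y.
  by rewrite -ball_normE.
near=> y; have : `|x - y| < e / Fbound by near: y; exact: H.
rewrite ltr_pdivlMr // mulrC => xy.
apply: le_lt_trans _ xy; rewrite ler_distl.
have h1 := FD y (x - y); have h2 := FD x (y - x).
have h3 := F_le (x - y); have h4 := F_le (y - x).
rewrite [y + _]addrC subrK in h1; rewrite [x + _]addrC subrK in h2.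
rewrite distrC in h4.
by apply/andP; split; lra.
Unshelve. all: by end_near. Qed.

(** The minimum of [F] on the compact unit sphere is positive, and homogeneity spreads the bound.
    The sphere may be empty, namely in dimension zero, hence the case distinction. *)
Lemma F_lower : exists2 c, 0 < c & forall x, c * `|x| <= F x.
Proof.
pose S := [set x : 'rV[R]_n | `|x| = 1].
have [[s Ss]|S0] := pselect (S !=set0); last first.
  exists 1 => // x; have [->|x0] := eqVneq x 0; first by rewrite normr0 mulr0 Fge0.
  case: S0; exists (`|x|^-1 *: x); rewrite /S /= normrZ normfV normr_id mulVf //.
  by rewrite normr_eq0.
have Sc : compact S.
  apply: bounded_closed_compact.
    by exists 1; split => // M M1 x /= ->; exact: ltW.
  apply: (@preimage_closed _ _ (fun x : 'rV[R]_n => `|x|) [set 1]).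
    by move=> x _; exact: norm_continuous.
  exact: closed_eq.
have [|c cS cmin] := EVT_min_rV (ex_intro _ s Ss) Sc (f := F).
  exact/continuous_subspaceT/F_continuous.
rewrite inE in cS.
have c0 : c != 0.
  by apply/eqP => c0; move: cS; rewrite /S /= c0 normr0 => /esym/eqP; rewrite oner_eq0.
exists (F c); first exact: Fgt0.
move=> x; have [->|x0] := eqVneq x 0; first by rewrite normr0 mulr0 Fge0.
have nx0 : 0 < `|x| by rewrite normr_gt0.
have : `|x|^-1 *: x \in S.
  by rewrite inE /S /= normrZ normfV normr_id mulVf // gt_eqF.
move=> /cmin; rewrite FZ normfV normr_id => H.
by rewrite -ler_pdivlMr // mulrC.
Qed.

Hypothesis n0 : (0 < n)%N.

Lemma dotpDr xi x y : dotp xi (x + y) = dotp xi x + dotp xi y.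
Proof.
by rewrite /dotp -big_split; apply: eq_bigr => i _; rewrite mxE mulrDr.
Qed.

Lemma dotp_le x y : `|dotp x y| <= n%:R * `|x| * `|y|.
Proof.
apply: le_trans (ler_norm_sum _ _ _) _.
have -> : n%:R * `|x| * `|y| = \sum_(i < n) `|x| * `|y|.
  by rewrite sumr_const card_ord -mulrA mulr_natl.
by apply: ler_sum => i _; rewrite normrM ler_pM // coord_le_norm.
Qed.

Lemma evec_neq0 (i : 'I_n) : evec R i != 0.
Proof.
apply/eqP => /rowP /(_ i); rewrite !mxE !eqxx /= => /eqP.
by rewrite oner_eq0.
Qed.

(** Makes the suprema defining [polar] genuine ones instead of default values, with control linear
    in [eta]. *)
Lemma polar_bound : exists2 L, 0 < L & forall xi eta, xi != 0 ->
  dotp xi eta / F xi <= L * `|eta|.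
Proof.
have [c c0 cF] := F_lower.
exists (n%:R / c) => [|xi eta xi0]; first by rewrite divr_gt0 // ltr0n.
rewrite ler_pdivrMr ?Fgt0 //; apply: le_trans (ler_norm _) _.
apply: le_trans (dotp_le _ _) _.
rewrite (_ : _ * _ * F xi = n%:R * `|eta| * (c^-1 * F xi)); last by ring.
rewrite mulrAC ler_wpM2l ?mulr_ge0 // mulrC ler_pdivlMr // mulrC; exact: cF.
Qed.

Let P eta := [set dotp xi eta / F xi | xi in [set xi | xi != 0]].

Let P_nonempty eta : P eta !=set0.
Proof.
pose i := Ordinal n0; exists (dotp (evec R i) eta / F (evec R i)).
by exists (evec R i) => //; exact: evec_neq0.
Qed.

Let P_ub eta : has_ubound (P eta).
Proof.
have [L _ HL] := polar_bound; exists (L * `|eta|) => _ [xi xi0 <-]; exact: HL.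
Qed.

Lemma polar_le : exists2 L, 0 < L & forall eta, polar F eta <= L * `|eta|.
Proof.
have [L L0 HL] := polar_bound; exists L => // eta.
apply: ge_sup; first exact: P_nonempty.
by move=> _ [xi xi0 <-]; exact: HL.
Qed.

Lemma polarD x y : polar F (x + y) <= polar F x + polar F y.
Proof.
apply: ge_sup; first exact: P_nonempty.
move=> _ [xi xi0 <-]; rewrite dotpDr mulrDl.
by apply: lerD; apply: ub_le_sup; [exact: P_ub|exists xi|exact: P_ub|exists xi].
Qed.

(** The supremum is tested on the basis vector of a largest coordinate of [eta], taken with the sign
    of that coordinate. *)
Lemma polar_lower : exists2 c, 0 < c & forall eta, c * `|eta| <= polar F eta.
Proof.
exists Fbound^-1 => [|eta]; first by rewrite invr_gt0 Fbound_gt0.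
have [i ->] := norm_coord eta n0.
pose xi := (Num.sg (eta 0 i)) *: evec R i.
(* A zero coordinate has sign 0, which would make the test vector inadmissible; the unsigned basis
   vector then gives the value 0. *)
have [e0|e0] := eqVneq (eta 0 i) 0.
  rewrite e0 normr0 mulr0.
  have h : P eta (dotp (evec R i) eta / F (evec R i)).
    by exists (evec R i) => //; exact: evec_neq0.
  apply: le_trans (ub_le_sup (P_ub eta) h).
  rewrite /dotp big1 ?mul0r // => j _; rewrite mxE eqxx /=.
  by have [->|] := eqVneq j i; [rewrite e0 mulr0|rewrite mul0r].
have xi0 : xi != 0 by rewrite scaler_eq0 sgr_eq0 (negbTE e0) evec_neq0.
have h : P eta (dotp xi eta / F xi) by exists xi.
apply: le_trans (ub_le_sup (P_ub eta) h).
have -> : dotp xi eta = `|eta 0 i|.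
  rewrite /dotp (bigD1 i) //= big1 ?addr0.
    by rewrite !mxE !eqxx /= mulr1 -normrEsg.
  by move=> j ji; rewrite !mxE eqxx (negbTE ji) /= mulr0 mul0r.
rewrite mulrC ler_pM2l ?normr_gt0 // lef_pV2 ?posrE ?Fbound_gt0 ?Fgt0 //.
rewrite FZ normr_sg e0 mul1r /Fbound ler_wpDl //.
by rewrite (bigD1 i) //= ler_wpDr // sumr_ge0 // => j _; exact: Fge0.
Qed.

Lemma polar_ge0 eta : 0 <= polar F eta.
Proof.
have [c c0 H] := polar_lower.
by apply: le_trans (H eta); rewrite mulr_ge0 // ltW.
Qed.

Lemma distF_ge0 (Omega : set 'rV[R]_n) x : 0 <= distF F Omega x.
Proof.
have [[y Hy]|H] := pselect (boundary Omega !=set0).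
  apply: lb_le_inf; first by exists (polar F (x - y)); exists y.
  by move=> _ [z _ <-]; exact: polar_ge0.
rewrite /distF (_ : boundary Omega = set0) ?image_set0 ?inf0 //.
by apply/eqP/negPn/negP => /set0P.
Qed.

(** Subadditivity of [polar] passes to the infimum. [L] is chosen before [Omega], which is what
    makes the final constant independent of the domain. *)
Lemma distF_lipschitz : exists2 L, 0 < L & forall (Omega : set 'rV[R]_n) x z,
  boundary Omega !=set0 ->
  `|distF F Omega x - distF F Omega z| <= L * `|x - z|.
Proof.
have [L L0 HL] := polar_le; exists L => // Omega.
have lb w : has_lbound [set polar F (w - y) | y in boundary Omega].
  by exists 0 => _ [y _ <-]; exact: polar_ge0.
suff H x z : boundary Omega !=set0 ->
    distF F Omega x <= distF F Omega z + L * `|x - z|.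
  move=> x z bn; rewrite ler_distl.
  have := H x z bn; have := H z x bn; rewrite [`|z - x|]distrC => h1 h2.
  by apply/andP; split; lra.
move=> [w Hw]; rewrite -lerBlDr; apply: lb_le_inf.
  by exists (polar F (z - w)); exists w.
move=> _ [y Hy <-]; rewrite lerBlDr.
apply: le_trans (ge_inf (lb x) _) _; first by exists y; [exact: Hy|].
rewrite (_ : x - y = (z - y) + (x - z)); last by rewrite [RHS]addrC addrA subrK.
by apply: le_trans (polarD _ _) _; rewrite lerD2l.
Qed.

(** A ball around [x] inside the open set contains no boundary point, and [polar] dominates a
    multiple of the maximum norm. *)
Lemma distF_gt0 (Omega : set 'rV[R]_n) x : open Omega ->
  boundary Omega !=set0 -> Omega x -> 0 < distF F Omega x.
Proof.
move=> Oo [w Hw] Ox; have [c c0 Hc] := polar_lower.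
have /nbhs_ballP[r /= r0 rO] : nbhs x Omega by move: Oo; rewrite openE; exact.
apply: (@lt_le_trans _ _ (c * r)); first by rewrite mulr_gt0.
apply: lb_le_inf; first by exists (polar F (x - w)); exists w.
move=> _ [y [_ Hy] <-]; apply: le_trans (Hc _).
rewrite ler_pM2l // leNgt; apply/negP => xy; apply: Hy.
rewrite openE in Oo; apply/Oo/rO.
by rewrite -ball_normE.
Qed.

End Norm.

(** * The weighted Sobolev inequality *)

Section PowerIncrement.
Variable R : realType.
Implicit Types a b r s : R.

(** Mean value theorem: the power [s - 1] is monotone, increasing or decreasing according to [s], so
    the sum of its end values covers both cases. *)
Lemma powR_increment_gt0 a b s : 0 <= s -> 0 < a -> 0 < b ->
  b `^ s - a `^ s <= s * (b `^ (s - 1) + a `^ (s - 1)) * `|b - a|.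
Proof.
move=> s0 a0 b0; have rhs0 : 0 <= s * (b `^ (s - 1) + a `^ (s - 1)) * `|b - a|.
  by rewrite mulr_ge0 // mulr_ge0 // addr_ge0 // powR_ge0.
have [ba|ab] := leP b a.
  apply: le_trans rhs0; rewrite subr_le0.
  by apply: ge0_ler_powR; rewrite // nnegrE ltW.
have [||c] := @MVT R (@powR R ^~ s) (fun x => s * x `^ (s - 1)) a b ab.
- move=> x; rewrite in_itv /= => /andP[ax _].
  by apply: is_derive1_powR; exact: lt_trans ax.
- apply: continuous_in_subspaceT => x; rewrite inE /= in_itv /= => /andP[ax _].
  by apply: continuous_powR_gt0; exact: lt_le_trans ax.
rewrite in_itv /= => /andP[ac cb] ->.
have c0 : 0 < c by exact: lt_trans ac.
rewrite (gtr0_norm (x := b - a)) ?subr_gt0 // ler_wpM2r ?subr_ge0 ?(ltW ab) //.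
rewrite ler_wpM2l //; have [s1|s1] := leP 1 s.
  apply: (@le_trans _ _ (b `^ (s - 1))); last by rewrite lerDl powR_ge0.
  by apply: ge0_ler_powR;
    rewrite ?nnegrE ?subr_ge0 ?(ltW s1) ?(ltW a0) ?(ltW b0) ?(ltW c0) ?(ltW ac) ?(ltW cb).
apply: (@le_trans _ _ (a `^ (s - 1))); last by rewrite lerDr powR_ge0.
rewrite -(opprB 1 s) !powRN lef_pV2 ?posrE ?powR_gt0 //.
by apply: ge0_ler_powR;
    rewrite ?nnegrE ?subr_ge0 ?(ltW s1) ?(ltW a0) ?(ltW b0) ?(ltW c0) ?(ltW ac) ?(ltW cb).
Qed.

(** Variant for powers of [|v|], which may vanish at either end, unlike the distance inside the
    domain. *)
Lemma powR_increment_ge1 a b r : 1 <= r -> 0 <= a -> 0 <= b ->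
  b `^ r - a `^ r <= r * (b `^ (r - 1) + a `^ (r - 1)) * `|b - a|.
Proof.
move=> r1 a0 b0; have r0 : 0 < r by lra.
have rhs0 : 0 <= r * (b `^ (r - 1) + a `^ (r - 1)) * `|b - a|.
  by rewrite mulr_ge0 // mulr_ge0 // ?(ltW r0) // addr_ge0 // powR_ge0.
have [->|bn0] := eqVneq b 0.
  rewrite powR0 ?gt_eqF // sub0r; apply: (@le_trans _ _ 0).
    by rewrite oppr_le0 powR_ge0.
  by rewrite mulr_ge0 // mulr_ge0 // ?(ltW r0) // addr_ge0 // powR_ge0.
have bp : 0 < b by rewrite lt_neqAle eq_sym bn0.
have [->|an0] := eqVneq a 0.
  rewrite (powR0 (x := r)) ?gt_eqF // !subr0 ger0_norm //.
  have -> : b `^ r = b `^ (r - 1) * b.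
    by rewrite -[X in _ * X](powRr1 b0) -powR_split ?subr_ge0 // subrK.
  rewrite ler_wpM2r //.
  rewrite -[leLHS]mul1r; apply: ler_pM => //; rewrite ?powR_ge0 //.
  by rewrite lerDl powR_ge0.
by apply: powR_increment_gt0; rewrite ?(ltW r0) // lt_neqAle eq_sym an0.
Qed.

End PowerIncrement.

Lemma mulrB_split (R : comPzRingType) (a b c e : R) :
  a * b - c * e = a * (b - e) + e * (a - c).
Proof. ring. Qed.

(** * Extension by zero of functions on the domain *)

Section Extension.
Variables (R : realType) (n : nat) (Omega : set 'rV[R]_n) (v : 'rV[R]_n -> R).
Hypothesis Oo : open Omega.
Hypothesis Cv : Cc_infty Omega v.
Implicit Types (h : 'rV[R]_n -> R) (x : 'rV[R]_n).

Definition zero_ext h x : R := if x \in Omega then h x else 0.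

Lemma open_compl_support : open (~` Defs.support v).
Proof. by apply: closed_openC; exact: closed_closure. Qed.

Lemma near_compl_support x : ~ Defs.support v x -> \forall y \near x, ~ Defs.support v y.
Proof. by move=> vx; move: open_compl_support; rewrite openE; apply. Qed.

Lemma v_out x : ~ Defs.support v x -> v x = 0.
Proof.
move=> vx; apply/eqP/negPn/negP => v0; apply: vx.
by apply: subset_closure.
Qed.

Lemma v_continuous : continuous v.
Proof. by have [/(_ [::]) [? _] _] := Cv. Qed.

Lemma v_derivable x i : derivable v x (evec R i).
Proof. by have [/(_ [::]) [_ +] _] := Cv; exact. Qed.

Lemma gradient_continuous : continuous (gradient v).
Proof.
apply: row_continuous => i.
rewrite (_ : (fun _ => _) = fun x => 'D_(evec R i) v x).
  by have [/(_ [:: i]) [+ _] _] := Cv.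
by apply/funext => x; rewrite mxE.
Qed.

Lemma gradient_out x : ~ Defs.support v x -> gradient v x = 0.
Proof.
move=> vx; apply/rowP => i; rewrite !mxE.
rewrite (@near_eq_derive _ _ _ v (cst 0)) ?derive_cst //.
by have := near_compl_support vx; apply: filterS => y /v_out.
Qed.

(** The domain and the complement of the support of [v] are open and cover the space; the extension
    is [h] on the first and 0 on the second, so negative powers of the distance at the boundary do
    no harm. *)
Lemma cc_ext h : (forall x, Omega x -> {for x, continuous h}) ->
  (forall x, Omega x -> ~ Defs.support v x -> h x = 0) -> cc (zero_ext h).
Proof.
move=> hc h0; have [_ [Kc KO]] := Cv.
have ext0 x : ~ Defs.support v x -> zero_ext h x = 0.
  by move=> vx; rewrite /zero_ext; case: ifPn => //; rewrite inE => Ox; exact: h0.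
split.
  move=> x; have [Ox|Ox] := pselect (Omega x).
    have E : \forall y \near x, h y = zero_ext h y.
      have : nbhs x Omega by move: Oo; rewrite openE; apply.
      by apply: filterS => y Oy; rewrite /zero_ext mem_set.
    rewrite /continuous_at (_ : zero_ext h x = h x); last by rewrite /zero_ext mem_set.
    exact: cvg_trans (near_eq_cvg E) (hc x Ox).
  have vx : ~ Defs.support v x by move=> /KO.
  rewrite /continuous_at ext0 //.
  have E : \forall y \near x, (fun=> 0) y = zero_ext h y.
    by apply: filterS (near_compl_support vx) => y /ext0 ->.
  by apply: cvg_trans (near_eq_cvg E) _; exact: cvg_cst.
have [M [_ HM]] := compact_bounded Kc.
exists (M + 1) => x i xM; apply: ext0 => Kx.
have H : `|x| <= M + 1 := HM (M + 1) ltac:(by rewrite ltrDl) x Kx.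
by have := le_lt_trans H xM; rewrite ltNge coord_le_norm.
Qed.

End Extension.

(** * Difference quotients of the weighted power along an axis *)

Section LineEstimate.
Variables (R : realType) (n : nat) (F : 'rV[R]_n -> R).
Hypothesis hF : strictly_convex_C1_norm F.
Hypothesis n0 : (0 < n)%N.
Variables (s r cF L : R).
Hypotheses (s0 : 0 <= s) (r1 : 1 <= r).
Hypothesis cF0 : 0 < cF.
Hypothesis hcF : forall x, cF * `|x| <= F x.
Hypothesis L0 : 0 < L.
Variables (Omega : set 'rV[R]_n) (v : 'rV[R]_n -> R).
Hypothesis Od : domain Omega.
Hypothesis Cv : Cc_infty Omega v.
Hypothesis hL : forall x z,
  `|distF F Omega x - distF F Omega z| <= L * `|x - z|.
Notation d := (distF F Omega).
Implicit Types x z w : 'rV[R]_n.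

Lemma d_continuous : continuous d.
Proof.
move=> x; apply/(@cvgrPdist_lt _ _ _ (nbhs x) (nbhs_filter x) d (d x)) => e e0.
have r0 : 0 < e / L by rewrite divr_gt0.
have H : \forall y \near x, `|x - y| < e / L.
  by apply/nbhs_ballP; exists (e / L) => //= y; rewrite -ball_normE.
near=> y; have : `|x - y| < e / L by near: y; exact: H.
rewrite ltr_pdivlMr // mulrC => xy.
exact: le_lt_trans (hL _ _) xy.
Unshelve. all: by end_near. Qed.

Lemma d_gt0 x : Omega x -> 0 < d x.
Proof. by case: Od => ? [_ ?] ?; exact: distF_gt0. Qed.

Lemma d_powR_continuous (t : R) x : Omega x -> {for x, continuous (fun w => d w `^ t)}.
Proof.
move=> Ox; apply: (@continuous_comp _ _ _ d (@powR R ^~ t)).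
  exact: d_continuous.
by apply: continuous_powR_gt0; exact: d_gt0.
Qed.

Lemma v_powR_continuous (t : R) : 0 <= t -> continuous (fun w => `|v w| `^ t).
Proof.
move=> t0 x; apply: (@continuous_comp _ _ _ v (fun y => `|y| `^ t)).
  exact: v_continuous Cv _.
exact: continuous_norm_powR.
Qed.

Lemma F_gradient_continuous : continuous (fun x => F (gradient v x)).
Proof.
move=> x; apply: (@continuous_comp _ _ _ (gradient v) F).
  exact: gradient_continuous Cv _.
exact: F_continuous.
Qed.

Definition weight_fun x : R := d x `^ s * `|v x| `^ r.
Definition weight_grad x : R :=
  d x `^ s * `|v x| `^ (r - 1) * F (gradient v x) + d x `^ (s - 1) * `|v x| `^ r.
(* The factor 2 comes from bounding power increments by the sum of the two end
   slopes. *)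
Definition slope_const : R := 2 * (r / cF + s * L) + 1.

Lemma slope_const_gt0 : 0 < slope_const.
Proof.
have r0 : 0 <= r by exact: le_trans ler01 r1.
have : 0 <= r / cF by apply: divr_ge0 => //; exact: ltW.
have : 0 <= s * L by apply: mulr_ge0 => //; exact: ltW.
rewrite /slope_const; lra.
Qed.

Lemma norm_evec (i : 'I_n) : `|evec R i| <= 1.
Proof.
rewrite -[leLHS]/(mx_norm _) mx_normrE; apply/bigmax_leP; split => // j _.
by rewrite mxE; case: (_ && _); rewrite ?normr1 ?normr0.
Qed.

(** A discrete product rule: the increment of [|v|] comes from differentiability of [v], that of the
    distance from its Lipschitz bound. *)
Lemma weight_slope z i e : Omega z -> 0 < e ->
  exists2 del, 0 < del & forall t, 0 < t < del ->
    Omega (z + t *: evec R i) /\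
    weight_fun (z + t *: evec R i) - weight_fun z <=
      (slope_const * weight_grad z + e) * t.
Proof.
move=> Oz e0.
have r0 : 0 <= r by exact: le_trans ler01 r1.
have r10 : 0 <= r - 1 by rewrite subr_ge0.
set D := `|'D_(evec R i) v z|.
(* Chosen so that the error in the expansion of [v] contributes at most [e / 2] to [k z]; the [+ 1]
   excludes a zero denominator. *)
pose e' := e / (4 * (d z `^ s * r * `|v z| `^ (r - 1) + 1)).
have T0 : 0 <= d z `^ s * r * `|v z| `^ (r - 1).
  by rewrite !mulr_ge0 ?powR_ge0.
have e'0 : 0 < e' by rewrite divr_gt0 // mulr_gt0 // ltr_wpDl.
(* [k w] bounds the difference quotient between [z] and [w]; by continuity it exceeds [k z] by less
   than [e / 2] near [z]. *)
pose k w := d w `^ s * r * (`|v w| `^ (r - 1) + `|v z| `^ (r - 1)) * (D + e') +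
  `|v z| `^ r * s * L * (d w `^ (s - 1) + d z `^ (s - 1)).
have kc : {for z, continuous k}.
  have H1 := d_powR_continuous (t := s) Oz.
  have H2 := d_powR_continuous (t := s - 1) Oz.
  have H3 : {for z, continuous (fun w => `|v w| `^ (r - 1))}.
    exact: v_powR_continuous.
  exact: (cvgD
    (cvgM (cvgM (cvgM H1 (cvg_cst r)) (cvgD H3 (cvg_cst _))) (cvg_cst _))
    (cvgM (cvg_cst _) (cvgD H2 (cvg_cst _)))).
have kz : k z + e / 2 <= slope_const * weight_grad z + e.
  have DF : D <= cF^-1 * F (gradient v z).
    rewrite mulrC ler_pdivlMr // mulrC; apply: le_trans (hcF _).
    rewrite ler_pM2l //; have := coord_le_norm (gradient v z) i.
    by rewrite mxE.
  rewrite /k /weight_grad /slope_const.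
  set a := d z `^ s; set b := `|v z| `^ (r - 1).
  set p1 := d z `^ (s - 1); set p2 := `|v z| `^ r.
  have a0 : 0 <= a by exact: powR_ge0.
  have b0 : 0 <= b by exact: powR_ge0.
  have p10 : 0 <= p1 by exact: powR_ge0.
  have p20 : 0 <= p2 by exact: powR_ge0.
  have Te : 2 * (a * r * b) * e' <= e / 2.
    rewrite /e' -/a -/b mulrCA.
    rewrite (_ : 2 * (a * r * b) / _ = (a * r * b) / (a * r * b + 1) / 2); last first.
      field; rewrite gt_eqF // ltr_wpDl //.
    rewrite ler_pM2l // ler_pdivrMr // mulVf // ler_pdivrMr ?mul1r ?lerDl //.
    by rewrite ltr_wpDl.
  have DT : 2 * (a * r * b) * D <= 2 * (r / cF) * (a * b * F (gradient v z)).
    rewrite (_ : 2 * (r / cF) * _ = 2 * (a * r * b) * (cF^-1 * F (gradient v z))); last by ring.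
    by rewrite ler_wpM2l // mulr_ge0.
  have X0 : 0 <= a * b * F (gradient v z) by rewrite !mulr_ge0 ?(Fge0 hF).
  have Y0 : 0 <= p1 * p2 by rewrite mulr_ge0.
  have sL0 : 0 <= s * L by rewrite mulr_ge0 // ltW.
  have rc0 : 0 <= r / cF by rewrite divr_ge0 // ltW.
  have Z1 : 0 <= (2 * (s * L) + 1) * (a * b * F (gradient v z)).
    by rewrite mulr_ge0 //; lra.
  have Z2 : 0 <= (2 * (r / cF) + 1) * (p1 * p2) by rewrite mulr_ge0 //; lra.
  lra.
have k2 : \forall w \near z, k w < k z + e / 2.
  by apply: (cvgr_lt (k z) kc); rewrite ltrDl divr_gt0.
have Onz : nbhs z Omega by case: Od => + _; rewrite openE; apply.
have /nbhs_ballP[d1 /= d10 Hd1] : nbhs z (Omega `&` [set w | k w < k z + e / 2]).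
  exact: filterI.
have [d2 d20 Hd2] := derivable_approx (v_derivable Cv (x := z) (i := i)) e'0.
exists (Num.min d1 d2); first by rewrite lt_min d10.
move=> t /andP[t0]; rewrite lt_min => /andP[td1 td2].
set w := z + t *: evec R i.
have zw : `|w - z| <= t.
  rewrite /w addrC addKr normrZ gtr0_norm // ler_piMr ?norm_evec //; exact: ltW.
have [Ow kw] : (Omega `&` [set w | k w < k z + e / 2]) w.
  by apply: Hd1; rewrite -ball_normE /= distrC; exact: le_lt_trans zw td1.
split => //.
have vB : `| `|v w| - `|v z| | <= (D + e') * t.
  apply: le_trans (ler_dist_dist _ _) _.
  have := Hd2 t; rewrite (gtr0_norm t0) => /(_ td2) H.
  have -> : v w - v z = (v w - v z - t * 'D_(evec R i) v z) + t * 'D_(evec R i) v z.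
    by rewrite subrK.
  apply: le_trans (ler_normD _ _) _.
  by rewrite normrM (gtr0_norm t0) -/D mulrDl addrC [t * D]mulrC lerD2l.
have dB : `|d w - d z| <= L * t.
  by apply: le_trans (hL _ _) _; rewrite ler_pM2l.
have I1 := powR_increment_ge1 r1 (normr_ge0 (v z)) (normr_ge0 (v w)).
have I2 := powR_increment_gt0 s0 (d_gt0 Oz) (d_gt0 Ow).
apply: (@le_trans _ _ (k w * t)); last first.
  by rewrite ler_pM2r // (le_trans (ltW kw)).
rewrite /weight_fun.
rewrite mulrB_split.
rewrite /k mulrDl; apply: lerD.
  apply: (@le_trans _ _ (d w `^ s * (r * (`|v w| `^ (r - 1) + `|v z| `^ (r - 1))
      * ((D + e') * t)))).
    rewrite ler_wpM2l ?powR_ge0 //; apply: le_trans I1 _.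
    by rewrite ler_wpM2l // mulr_ge0 // addr_ge0 // powR_ge0.
  by rewrite !mulrA.
apply: (@le_trans _ _ (`|v z| `^ r * (s * (d w `^ (s - 1) + d z `^ (s - 1))
    * (L * t)))).
  rewrite ler_wpM2l ?powR_ge0 //; apply: le_trans I2 _.
  by rewrite ler_wpM2l // mulr_ge0 // addr_ge0 // powR_ge0.
by rewrite !mulrA; move: (`|v z| `^ r) (d w `^ (s - 1) + d z `^ (s - 1)) => x y;
  rewrite [x * s * y * L]mulrAC.
Qed.

End LineEstimate.

(** * From slopes to line integrals *)

Section LineDomination.
Variables (R : realType) (n : nat) (F : 'rV[R]_n -> R).
Hypothesis hF : strictly_convex_C1_norm F.
Hypothesis n0 : (0 < n)%N.
Variables (s r cF L : R).
Hypotheses (s0 : 0 <= s) (r1 : 1 <= r).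
Hypothesis cF0 : 0 < cF.
Hypothesis hcF : forall x : 'rV[R]_n, cF * `|x| <= F x.
Hypothesis L0 : 0 < L.
Variables (Omega : set 'rV[R]_n) (v : 'rV[R]_n -> R).
Hypothesis Od : domain Omega.
Hypothesis Cv : Cc_infty Omega v.
Hypothesis hL : forall x z : 'rV[R]_n,
  `|distF F Omega x - distF F Omega z| <= L * `|x - z|.
Notation d := (distF F Omega).
Notation wf := (zero_ext Omega (weight_fun F s r Omega v)).
Notation wg := (zero_ext Omega (weight_grad F s r Omega v)).
Notation kappa := (slope_const s r cF L).

Let r0 : 0 < r. Proof. exact: lt_le_trans r1. Qed.
Let Oo : open Omega. Proof. by case: Od. Qed.

Lemma weight_fun_ge0 x : 0 <= wf x.
Proof. by rewrite /zero_ext; case: ifP => // _; rewrite mulr_ge0 // powR_ge0. Qed.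

Lemma weight_grad_ge0 x : 0 <= wg x.
Proof.
rewrite /zero_ext; case: ifP => // _.
by rewrite addr_ge0 // !mulr_ge0 ?powR_ge0 // (Fge0 hF).
Qed.

Lemma cc_weight_fun : cc wf.
Proof.
apply: (cc_ext Oo Cv) => x Ox.
  exact: (cvgM (d_powR_continuous hF n0 L0 Od hL (t := s) Ox)
               (v_powR_continuous Cv (ltW r0) (x := x))).
by move=> vx; rewrite /weight_fun (v_out vx) normr0 powR0 ?mulr0 ?gt_eqF.
Qed.

Lemma cc_weight_grad : cc wg.
Proof.
apply: (cc_ext Oo Cv) => x Ox.
  have r10 : 0 <= r - 1 by rewrite subr_ge0.
  exact: (cvgD
   (cvgM (cvgM (d_powR_continuous hF n0 L0 Od hL (t := s) Ox)
               (v_powR_continuous Cv r10 (x := x)))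
         (F_gradient_continuous hF Cv (x := x)))
   (cvgM (d_powR_continuous hF n0 L0 Od hL (t := s - 1) Ox)
         (v_powR_continuous Cv (ltW r0) (x := x)))).
move=> vx; rewrite /weight_grad (gradient_out vx) (F_0 hF) mulr0 (v_out vx).
by rewrite normr0 (powR0 (x := r)) ?mulr0 ?addr0 ?gt_eqF.
Qed.

Lemma updD (i : 'I_n) (c t : R) (x : 'rV[R]_n) :
  upd i (c + t) x = upd i c x + t *: evec R i.
Proof.
apply/rowP => j; rewrite !mxE eqxx /=.
by case: eqP => _; rewrite ?mulr1 ?mulr0 ?addr0.
Qed.

Lemma upd_continuous (i : 'I_n) (x : 'rV[R]_n) : continuous (fun t => upd i t x).
Proof.
apply: row_continuous => j.
under eq_fun do rewrite mxE.
by case: eqP => _ t; [exact: cvg_id|exact: cst_continuous].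
Qed.

Lemma weight_line_dominated : line_dominated wf (fun x => kappa * wg x).
Proof.
move=> i x; have [fc [M fM]] := cc_weight_fun.
have [gc [N gN]] := ccZ kappa cc_weight_grad.
(* The integration starts to the left of [x 0 i] and outside the cube of the support, where the
   function vanishes; [|M|] serves since [M] may be negative. *)
pose a := Num.min (x 0 i) (- (`|M| + 1)).
have ax : a <= x 0 i by rewrite ge_min lexx.
have kap0 : 0 < kappa by exact: slope_const_gt0.
have updi t : upd i t x 0 i = t by rewrite mxE eqxx.
have wfa : wf (upd i a x) = 0.
  apply: (fM _ i); rewrite updi.
  have : a <= - (`|M| + 1) by rewrite ge_min lexx orbT.
  move=> aM; have M1 := ler_norm M; have M0 := normr_ge0 M.
  have : - a <= `|a| by rewrite -normrN ler_norm.
  lra.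
have updx : upd i (x 0 i) x = x.
  by apply/rowP => j; rewrite mxE; case: eqP => [->|].
rewrite -{1}updx -[leLHS]subr0 -wfa.
apply: (le_int_upper_gradient (h := fun t => wf (upd i t x))
  (g := fun t => kappa * wg (upd i t x))) => //.
- move=> t; apply: (@continuous_comp _ _ _ (fun t => upd i t x) wf).
    exact: upd_continuous.
  exact: fc.
- split; last by exists N => t tN; apply: (gN _ i); rewrite updi.
  move=> t; apply: (@continuous_comp _ _ _ (fun t => upd i t x)
    (fun y => kappa * wg y)); [exact: upd_continuous|exact: gc].
- by move=> t; rewrite mulr_ge0 ?weight_grad_ge0 // ltW.
(* Outside the domain the slope bound is trivial: the point is off the support, so the function
   vanishes nearby. *)
move=> c e e0; have [Oc|Oc] := pselect (Omega (upd i c x)).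
  have [del del0 Hdel] :=
    weight_slope hF n0 s0 r1 cF0 hcF L0 Od Cv hL i Oc e0.
  near=> y; have cy : c < y by [].
  have [|] := Hdel (y - c).
    rewrite subr_gt0 cy /= ltrBlDl; near: y.
    by apply: nbhs_right_lt; rewrite ltrDl.
  by rewrite -updD subrKC => Oy; rewrite /zero_ext !mem_set.
have vc : ~ Defs.support v (upd i c x) by case: Cv => _ [_ KO] /KO.
have wf0 z : ~ Defs.support v z -> wf z = 0.
  move=> vz; rewrite /zero_ext /weight_fun (v_out vz) normr0 powR0 ?gt_eqF // mulr0.
  by case: ifP.
have Hc : \forall y \near c, ~ Defs.support v (upd i y x).
  exact: (@upd_continuous i x c _ (near_compl_support vc)).
near=> y; have cy : c < y by [].
have vy : ~ Defs.support v (upd i y x) by near: y; exact: cvg_within Hc.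
rewrite !wf0 // subr0 mulr_ge0 ?subr_ge0 ?(ltW cy) //.
by rewrite addr_ge0 ?(ltW e0) // mulr_ge0 ?weight_grad_ge0 // ltW.
Unshelve. all: by end_near. Qed.

End LineDomination.

Lemma weighted_sobolev (R : realType) (m : nat) (F : 'rV[R]_m.+2 -> R) (s r : R) :
  strictly_convex_C1_norm F -> 0 <= s -> 1 <= r ->
  exists2 K : R, 0 < K &
  forall (Omega : set 'rV[R]_m.+2) (v : 'rV[R]_m.+2 -> R),
    domain Omega -> Cc_infty Omega v ->
  forall A, 0 < A -> intRn (zero_ext Omega (weight_grad F s r Omega v)) <= A ->
  intRn (fun x => zero_ext Omega (weight_fun F s r Omega v) x `^ (1 + m.+1%:R^-1))
    <= (K * A) `^ (1 + m.+1%:R^-1).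
Proof.
move=> hF s0 r1; have [c c0 hc] := F_lower hF.
have [L L0 hL] := distF_lipschitz hF (ltn0Sn m.+1).
have K0 : 0 < slope_const s r c L by exact: slope_const_gt0.
exists (slope_const s r c L) => // Omega v Od Cv A A0 gA.
have hL' x z := hL Omega x z (proj2 (proj2 Od)).
have gcc := cc_weight_grad hF (ltn0Sn m.+1) s r1 L0 Od Cv hL'.
apply: (gagliardo_nirenberg
  (g := fun x => slope_const s r c L * zero_ext Omega (weight_grad F s r Omega v) x)).
- exact: (cc_weight_fun hF (ltn0Sn m.+1) s r1 L0 Od Cv hL').
- exact: ccZ.
- by move=> x; exact: weight_fun_ge0.
- by move=> x; rewrite mulr_ge0 ?(ltW K0) ?weight_grad_ge0.
- by rewrite mulr_gt0.
- by rewrite intRnZ // ler_pM2l.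
- exact: (weight_line_dominated hF (ltn0Sn m.+1) s0 r1 c0 hc L0 Od Cv hL').
Qed.

(** * Interpolation *)

Section Interpolation.
Variable R : realType.
Implicit Types a b f p q s r beta theta : R.

Lemma powR_invM a b t : 0 < a -> 0 <= b -> (b / a) `^ t = b `^ t * a `^ (- t).
Proof.
move=> a0 b0; rewrite powRM // ?invr_ge0 ?(ltW a0) //.
by rewrite -powR_inv1 ?(ltW a0) // -powRrM mulN1r.
Qed.

Lemma powRD_gt0 a s t : 0 < a -> a `^ (s + t) = a `^ s * a `^ t.
Proof. by move=> a0; apply: powRD; rewrite (gt_eqF a0) /= implybT. Qed.

(* Here [s] and [r] are forced by homogeneity in [a] and [b]. *)
Lemma weight_interpolation a b f p q beta theta s r :
  0 < a -> 0 <= b -> 0 <= f -> 1 <= p -> 0 <= q ->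
  0 <= theta <= 1 - p^-1 ->
  s = theta * (1 + beta * q) -> r = p + (q - p) * theta ->
  a `^ s * b `^ (r - 1) * f + a `^ (s - 1) * b `^ r <=
  2 * ((b `^ p / a + a `^ (p - 1) * f `^ p) `^ (1 - theta) *
       ((a `^ beta * b) `^ q) `^ theta).
Proof.
move=> a0 b0 f0 p1 q0 /andP[t0 tp] sE rE.
have p0 : 0 < p by lra.
have pn0 : p != 0 by rewrite gt_eqF.
have ppi : p * p^-1 = 1 by rewrite divff.
have pi0 : 0 < p^-1 by rewrite invr_gt0.
set X := b `^ p / a; set Y := a `^ (p - 1) * f `^ p.
have X0 : 0 <= X by rewrite divr_ge0 ?powR_ge0 // ltW.
have Y0 : 0 <= Y by rewrite mulr_ge0 // powR_ge0.
set U := ((a `^ beta * b) `^ q) `^ theta.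
have U0 : 0 <= U by exact: powR_ge0.
have UE : U = a `^ (beta * q * theta) * b `^ (q * theta).
  by rewrite /U powRM ?powR_ge0 // powRM ?powR_ge0 // -!powRrM mulrA.
have XE t : X `^ t = b `^ (p * t) * a `^ (- t).
  by rewrite /X powR_invM ?powR_ge0 // -powRrM.
have YE : Y `^ p^-1 = a `^ ((p - 1) * p^-1) * f.
  by rewrite /Y powRM ?powR_ge0 // -!powRrM ppi powRr1.
set t := 1 - p^-1 - theta; have tt0 : 0 <= t by rewrite /t; lra.
have H1 : a `^ s * b `^ (r - 1) * f = Y `^ p^-1 * X `^ t * U.
  rewrite YE XE UE.
  have -> : r - 1 = p * t + q * theta.
    rewrite rE /t !mulrBr ppi; lra.
  have -> : s = (p - 1) * p^-1 + - t + beta * q * theta.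
    rewrite sE /t mulrBl ppi; lra.
  rewrite (powR_split b0 (mulr_ge0 (ltW p0) tt0) (mulr_ge0 q0 t0)).
  by rewrite !(powRD_gt0 _ _ a0); ring.
have H2 : a `^ (s - 1) * b `^ r = X `^ (1 - theta) * U.
  rewrite XE UE.
  have -> : r = p * (1 - theta) + q * theta by rewrite rE; lra.
  have -> : s - 1 = - (1 - theta) + beta * q * theta by rewrite sE; lra.
  have th1 : 0 <= 1 - theta by lra.
  rewrite (powR_split b0 (mulr_ge0 (ltW p0) th1) (mulr_ge0 q0 t0)).
  by rewrite (powRD_gt0 _ _ a0); ring.
have XY0 : 0 <= X + Y by exact: addr_ge0.
have XXY : X <= X + Y by rewrite lerDl.
have YXY : Y <= X + Y by rewrite lerDr.
rewrite H1 H2 mulr_natl mulr2n; apply: lerD.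
  rewrite ler_wpM2r // (_ : 1 - theta = p^-1 + t); last by rewrite /t; lra.
  rewrite (powR_split (addr_ge0 X0 Y0) (ltW pi0) tt0).
  apply: ler_pM; [exact: powR_ge0|exact: powR_ge0| |].
    by apply: (ge0_ler_powR (ltW pi0)); rewrite ?nnegrE.
  by apply: (ge0_ler_powR tt0); rewrite ?nnegrE.
have th1 : 0 <= 1 - theta by lra.
by rewrite ler_wpM2r //; apply: (ge0_ler_powR th1); rewrite ?nnegrE.
Qed.

Lemma absorb (Q A k e theta : R) : 0 < Q -> 0 < A -> 0 < k -> 0 < e ->
  0 <= theta < 1 -> Q <= (k * (A `^ (1 - theta) * Q `^ theta)) `^ e ->
  Q `^ ((e^-1 - theta) / (1 - theta)) <= k `^ (1 - theta)^-1 * A.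
Proof.
move=> Q0 A0 k0 e0 /andP[t0 t1] H.
have u0 : 0 < 1 - theta by rewrite subr_gt0.
have H' : Q `^ e^-1 <= k * (A `^ (1 - theta) * Q `^ theta).
  rewrite -[leRHS](powRr1 (a := _)) ?mulr_ge0 ?powR_ge0 ?(ltW k0) //.
  rewrite -[X in _ <= _ `^ X](divff (lt0r_neq0 e0)) powRrM.
  apply: ge0_ler_powR; rewrite ?nnegrE ?powR_ge0 ?(ltW Q0) //.
  by rewrite invr_ge0 ltW.
have H'' : Q `^ (e^-1 - theta) <= k * A `^ (1 - theta).
  rewrite powRD_gt0 // powRN ler_pdivrMr ?powR_gt0 //.
  by rewrite -mulrA.
rewrite powRrM.
apply: (@le_trans _ _ ((k * A `^ (1 - theta)) `^ (1 - theta)^-1)).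
  apply: ge0_ler_powR; rewrite ?nnegrE ?mulr_ge0 ?powR_ge0 ?(ltW k0) //.
  by rewrite invr_ge0 ltW.
rewrite powRM ?powR_ge0 ?(ltW k0) // -powRrM divff ?gt_eqF // powRr1 //.
exact: ltW.
Qed.

End Interpolation.

(** * Conclusion *)

Section Exponents.
Variables (R : realFieldType) (x p a : R).
Hypotheses (x0 : 0 < x) (p0 : 0 < p) (a0 : 0 < a) (D0 : 0 < x + 1 - p * a).
Notation q := ((x + 1) * p / (x + 1 - p * a)).
Notation beta := (a - p^-1).
Notation theta := (1 - (p * a)^-1).

Let x1 : x + 1 != 0. Proof. by rewrite gt_eqF // addr_gt0. Qed.
Let nz := (lt0r_neq0 x0, lt0r_neq0 p0, lt0r_neq0 a0, lt0r_neq0 D0, x1).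

(** Here [x] is n - 1 and [a] is 1 - alpha, so [1 + x^-1] is n / (n - 1). This identity and the next
    express f^(n/(n-1)) = u, for the weight and for [|v|]. *)
Lemma sobolev_exponent_weight :
  theta * (1 + beta * q) * (1 + x^-1) = beta * q.
Proof. by field; rewrite !nz. Qed.

Lemma sobolev_exponent_power : (p + (q - p) * theta) * (1 + x^-1) = q.
Proof. by field; rewrite !nz. Qed.

Lemma absorbed_exponent : ((1 + x^-1)^-1 - theta) / (1 - theta) = p / q.
Proof. by field; rewrite subKr oner_eq0 !nz. Qed.

(** The right-hand side displays the sign of the interpolation parameter when [beta] is negative. *)
Lemma hardy_exponent_weight : 1 + beta * q = q * a * x / (x + 1).
Proof. by field; rewrite !nz. Qed.

Lemma hardy_exponent_power :
  p * (1 - (1 + beta * q)) + p * (1 + x^-1) * (1 + beta * q) = q.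
Proof. by field; rewrite !nz. Qed.

(** The total power of the energy bound is 1 after raising to [p / q]. *)
Lemma hardy_exponent_ratio :
  ((1 - (1 + beta * q)) + (1 + x^-1) * (1 + beta * q)) * (p / q) = 1.
Proof. by field; rewrite !nz. Qed.

End Exponents.

(** * The absorption case and the geometric mean case *)

Section MainEstimate.
Variables (R : realType) (m : nat) (F : 'rV[R]_m.+2 -> R).
Hypothesis hF : strictly_convex_C1_norm F.
Variables (beta p q : R).
Hypotheses (p1 : 1 <= p) (q0 : 0 < q).

Let p0 : 0 < p. Proof. exact: lt_le_trans p1. Qed.

Definition weight_target Omega (v : 'rV[R]_m.+2 -> R) x : R :=
  (distF F Omega x `^ beta * `|v x|) `^ q.
Definition weight_energy Omega (v : 'rV[R]_m.+2 -> R) x : R :=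
  `|v x| `^ p / distF F Omega x +
  distF F Omega x `^ (p - 1) * F (gradient v x) `^ p.

Section FixedDomain.
Variables (Omega : set 'rV[R]_m.+2) (v : 'rV[R]_m.+2 -> R).
Hypotheses (Od : domain Omega) (Cv : Cc_infty Omega v).
Notation d := (distF F Omega).
Notation u := (zero_ext Omega (weight_target Omega v)).
Notation e := (zero_ext Omega (weight_energy Omega v)).

Let Oo : open Omega. Proof. by case: Od. Qed.

Let hL : exists2 L, 0 < L &
  forall x z : 'rV[R]_m.+2, `|d x - d z| <= L * `|x - z|.
Proof.
have [L L0 hL] := distF_lipschitz hF (ltn0Sn m.+1).
by exists L => // x z; apply: hL; case: Od => _ [].
Qed.

Let d_gt0 x : Omega x -> 0 < d x.
Proof. exact: (d_gt0 hF (ltn0Sn m.+1) Od). Qed.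

Lemma cc_target : cc u.
Proof.
have [L L0 L1] := hL; apply: (cc_ext Oo Cv) => x Ox.
  apply: continuous_powR_nonneg; first exact: ltW.
    by move=> y; rewrite mulr_ge0 // powR_ge0.
  apply: (cvgM (d_powR_continuous hF (ltn0Sn m.+1) L0 Od L1 (t := beta) Ox)).
  by apply: cvg_norm; exact: v_continuous Cv _.
by move=> vx; rewrite /weight_target (v_out vx) normr0 mulr0 powR0 // gt_eqF.
Qed.

Lemma cc_energy : cc e.
Proof.
have [L L0 L1] := hL; apply: (cc_ext Oo Cv) => x Ox.
  have H1 : {for x, continuous (fun y => (d y)^-1)}.
    have dn0 : d x != 0 by rewrite gt_eqF // d_gt0.
    exact: (cvgV dn0 (d_continuous L0 L1 (x := x))).
  have H2 : {for x, continuous (fun y => F (gradient v y) `^ p)}.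
    apply: continuous_powR_nonneg; first exact: ltW.
      by move=> y; exact: (Fge0 hF).
    exact: (F_gradient_continuous hF Cv).
  exact: (cvgD (cvgM (v_powR_continuous Cv (ltW p0) (x := x)) H1)
    (cvgM (d_powR_continuous hF (ltn0Sn m.+1) L0 Od L1 (t := p - 1) Ox) H2)).
move=> vx; rewrite /weight_energy (gradient_out vx) (F_0 hF) (v_out vx).
by rewrite normr0 powR0 ?gt_eqF // mulr0 mul0r addr0.
Qed.

Lemma target_ge0 x : 0 <= u x.
Proof. by rewrite /zero_ext; case: ifP => // _; exact: powR_ge0. Qed.

Lemma energy_ge0 x : 0 <= e x.
Proof.
rewrite /zero_ext; case: ifP => // _; rewrite /weight_energy addr_ge0 //.
  by rewrite mulr_ge0 ?powR_ge0 // invr_ge0 (distF_ge0 hF).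
by rewrite mulr_ge0 ?powR_ge0.
Qed.

Lemma weight_grad_hoelder (theta s r A B : R) :
  0 <= theta <= 1 - p^-1 -> s = theta * (1 + beta * q) ->
  r = p + (q - p) * theta -> 0 <= s -> 1 <= r ->
  0 < A -> 0 < B -> intRn e <= A -> intRn u <= B ->
  intRn (zero_ext Omega (weight_grad F s r Omega v)) <=
    2 * (A `^ (1 - theta) * B `^ theta).
Proof.
move=> tp sE rE s0 r1 A0 B0 eA uB.
have [L L0 L1] := hL.
have gcc : cc (zero_ext Omega (weight_grad F s r Omega v)).
  exact: (cc_weight_grad hF (ltn0Sn m.+1) s r1 L0 Od Cv L1).
have p10 : 0 < p^-1 by rewrite invr_gt0.
have t01 : 0 <= theta < 1 by case/andP: tp => -> /=; lra.
(* Hoelder is applied to half the integrand, which disposes of the factor 2 of the pointwise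
   bound. *)
rewrite mulrC -ler_pdivrMr // mulrC -intRnZ //.
apply: (intRn_hoelder t01 cc_energy cc_target) => //.
- exact: ccZ.
- exact: energy_ge0.
- exact: target_ge0.
move=> x; rewrite mulrC ler_pdivrMr // [leRHS]mulrC /zero_ext.
case: ifPn => [|_]; last by rewrite mulr_ge0 // mulr_ge0 ?powR_ge0.
rewrite inE => Ox; apply: (weight_interpolation (d_gt0 Ox)) => //.
- exact: (Fge0 hF).
- exact: ltW.
Qed.

End FixedDomain.

Let e1 : R := 1 + m.+1%:R^-1.
Let e1_gt0 : 0 < e1. Proof. by rewrite ltr_pwDl // invr_ge0. Qed.

Lemma main_estimate_absorb (theta s r : R) :
  0 <= theta <= 1 - p^-1 -> s = theta * (1 + beta * q) ->
  r = p + (q - p) * theta -> 0 <= s -> 1 <= r ->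
  s * e1 = beta * q -> r * e1 = q -> (e1^-1 - theta) / (1 - theta) = p / q ->
  exists2 C : R, 0 < C & forall Omega v, domain Omega -> Cc_infty Omega v ->
    forall A, 0 < A -> intRn (zero_ext Omega (weight_energy Omega v)) <= A ->
    intRn (zero_ext Omega (weight_target Omega v)) `^ (p / q) <= C * A.
Proof.
move=> tp sE rE s0 r1 se re pq.
have [K K0 HK] := weighted_sobolev hF s0 r1.
have p10 : 0 < p^-1 by rewrite invr_gt0.
have t01 : 0 <= theta < 1 by case/andP: tp => -> /=; lra.
have K2 : 0 < K * 2 by rewrite mulr_gt0.
exists ((K * 2) `^ (1 - theta)^-1); first exact: powR_gt0.
move=> Omega v Od Cv A A0 eA.
set Q := intRn _.
have Q0 : 0 <= Q by apply: intRn_ge0; [exact: cc_target|exact: target_ge0].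
(* Absorption divides by a power of [Q], so [Q = 0] is treated apart. *)
have [->|Qn0] := eqVneq Q 0.
  by rewrite powR0 ?mulr_ge0 ?powR_ge0 ?(ltW A0) // gt_eqF // divr_gt0.
have Qp : 0 < Q by rewrite lt_neqAle eq_sym Qn0.
have wg := weight_grad_hoelder Od Cv tp sE rE s0 r1 A0 Qp eA (lexx Q).
have X0 : 0 < 2 * (A `^ (1 - theta) * Q `^ theta).
  by rewrite !mulr_gt0 ?powR_gt0.
have := HK Omega v Od Cv _ X0 wg.
rewrite -/e1 mulrA -pq.
have -> : intRn (fun x => zero_ext Omega (weight_fun F s r Omega v) x `^ e1) = Q.
  apply: intRn_ext => x; rewrite /zero_ext; case: ifP => _; last by rewrite powR0 ?gt_eqF.
  rewrite /weight_fun /weight_target !powRM ?powR_ge0 //.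
  by rewrite -!powRrM se re.
by move=> H; apply: absorb => //; rewrite e1_gt0.
Qed.

Lemma main_estimate_hardy (t : R) : t = 1 + beta * q -> 0 <= t < 1 ->
  p * (1 - t) + p * e1 * t = q -> ((1 - t) + e1 * t) * (p / q) = 1 ->
  exists2 C : R, 0 < C & forall Omega v, domain Omega -> Cc_infty Omega v ->
    forall A, 0 < A -> intRn (zero_ext Omega (weight_energy Omega v)) <= A ->
    intRn (zero_ext Omega (weight_target Omega v)) `^ (p / q) <= C * A.
Proof.
move=> tE t01 tq tr; have /andP[t0 t1] := t01.
have [K K0 HK] := weighted_sobolev hF (lexx 0) p1.
have K2 : 0 < K * 2 by rewrite mulr_gt0.
exists ((K * 2) `^ (e1 * t * (p / q))); first exact: powR_gt0.
move=> Omega v Od Cv A A0 eA.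
have ucc := cc_target Od Cv; have ecc := cc_energy Od Cv.
set Q := intRn _.
have Q0 : 0 <= Q by apply: intRn_ge0 => //; exact: target_ge0.
have tp : 0 <= (0 : R) <= 1 - p^-1 by rewrite lexx subr_ge0 invf_le1.
(* Any positive bound on [Q] will do: with theta = 0 it enters to the power 0. *)
have Q1 : Q <= Q + 1 by rewrite lerDl.
have Q10 : 0 < Q + 1 by rewrite ltr_wpDl.
have rE : p = p + (q - p) * 0 by rewrite mulr0 addr0.
have sE : 0 = 0 * (1 + beta * q) by rewrite mul0r.
have := weight_grad_hoelder Od Cv tp sE rE (lexx 0) p1 A0 Q10 eA Q1.
rewrite subr0 powRr1 ?(ltW A0) // powRr0 mulr1 => wg.
have A20 : 0 < 2 * A by rewrite mulr_gt0.
have := HK Omega v Od Cv _ A20 wg; rewrite -/e1 (mulrA K) => H.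
have B0 : 0 < (K * 2 * A) `^ e1 by rewrite powR_gt0 // mulr_gt0.
have [L L0 L1] := distF_lipschitz hF (ltn0Sn m.+1).
have wcc : cc (zero_ext Omega (weight_fun F 0 p Omega v)).
  apply: (cc_weight_fun hF (ltn0Sn m.+1) 0 p1 L0 Od Cv) => x z.
  by apply: L1; case: Od => _ [].
have Qle : Q <= A `^ (1 - t) * ((K * 2 * A) `^ e1) `^ t.
  have gcc : cc (fun x => zero_ext Omega (weight_fun F 0 p Omega v) x `^ e1).
    by apply: cc_powR => // x; exact: weight_fun_ge0.
  apply: (intRn_hoelder t01 ecc gcc ucc _ _ _ A0 B0 eA H).
  - by move=> x; exact: energy_ge0.
  - by move=> x; exact: powR_ge0.
  move=> x; rewrite /zero_ext; case: ifPn => [|_]; last first.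
    by rewrite mulr_ge0 ?powR_ge0.
  rewrite inE => Ox.
  have dx : 0 < distF F Omega x by exact: (d_gt0 hF (ltn0Sn m.+1) Od).
  have s0 : 0 <= 1 - t by rewrite subr_ge0 ltW.
  (* The power of the distance forces the parameter: [beta * q = - (1 - t)]. That the powers of
     [|v|] then agree is [tq]. *)
  have -> : weight_target Omega v x =
      (`|v x| `^ p / distF F Omega x) `^ (1 - t) *
      (weight_fun F 0 p Omega v x `^ e1) `^ t.
    rewrite /weight_target /weight_fun powRr0 mul1r powRM ?powR_ge0 //.
    rewrite powR_invM ?powR_ge0 // -!powRrM mulrAC.
    rewrite -(powR_split (normr_ge0 _)) ?mulr_ge0 ?(ltW p0) ?(ltW e1_gt0) //.
    by rewrite mulrA tq mulrC opprB tE [1 + _]addrC addrK.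
  rewrite ler_wpM2r ?powR_ge0 //; apply: (ge0_ler_powR s0).
  - by rewrite nnegrE divr_ge0 ?powR_ge0 // ltW.
  - by rewrite nnegrE addr_ge0 // ?divr_ge0 ?mulr_ge0 ?powR_ge0 // ltW.
  - by rewrite lerDl mulr_ge0 ?powR_ge0.
have pq0 : 0 <= p / q by rewrite divr_ge0 // ltW.
apply: le_trans (ge0_ler_powR pq0 _ _ Qle) _.
- by rewrite nnegrE.
- by rewrite nnegrE mulr_ge0 ?powR_ge0.
rewrite /= -powRrM (powRM _ (ltW K2) (ltW A0)) mulrCA -(powRD_gt0 _ _ A0).
rewrite [leLHS]powRM ?powR_ge0 // -!powRrM tr powRr1 //.
exact: ltW.
Qed.

End MainEstimate.

Theorem mainTheorem2 (R : realType) (n : nat) (F : 'rV[R]_n -> R)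
    (alpha p : R) :
  (2 <= n)%N ->
  strictly_convex_C1_norm F ->
  0 <= alpha < 1 ->
  1 <= p < n%:R / (1 - alpha) ->
  let q := n%:R * p / (n%:R - p * (1 - alpha)) in
  exists C2 : R, 0 < C2 /\
    forall (Omega : set 'rV[R]_n) (v : 'rV[R]_n -> R),
      domain Omega -> Cc_infty Omega v ->
      let d := distF F Omega in
      ((integralRn (fun x =>
          (if x \in Omega
           then (d x `^ (1 - p^-1 - alpha) * `|v x|) `^ q
           else 0)%:E)) `^ (p / q) <=
       C2%:E * integralRn (fun x =>
          (if x \in Omega
           then `|v x| `^ p / d x + d x `^ (p - 1) * F (gradient v x) `^ p
           else 0)%:E))%E.
Proof.
case: n F => [|[|m]] F // _ hF /andP[a0 a1] /andP[p1 pn].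
set q := _ / (_ - _).
have p0 : 0 < p by exact: lt_le_trans p1.
have b0 : 0 < 1 - alpha by rewrite subr_gt0.
have x0 : 0 < m.+1%:R :> R by [].
have D0 : 0 < m.+1%:R + 1 - p * (1 - alpha).
  by rewrite natr1 subr_gt0 -ltr_pdivlMr.
have qE : q = (m.+1%:R + 1) * p / (m.+1%:R + 1 - p * (1 - alpha)).
  by rewrite natr1.
have q0 : 0 < q by rewrite qE divr_gt0 // mulr_gt0 // addr_gt0.
have bE : 1 - p^-1 - alpha = (1 - alpha) - p^-1 by rewrite addrAC.
suff [C C0 HC] : exists2 C : R, 0 < C & forall Omega v,
    domain Omega -> Cc_infty Omega v -> forall A, 0 < A ->
    intRn (zero_ext Omega (weight_energy F p Omega v)) <= A ->
    intRn (zero_ext Omega (weight_target F (1 - p^-1 - alpha) q Omega v)) `^ (p / q)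
      <= C * A.
  exists C; split => // Omega v Od Cv; cbv zeta.
  rewrite (integralRnE (cc_target hF _ q0 Od Cv)).
  rewrite (integralRnE (cc_energy hF p1 Od Cv)).
  rewrite poweR_EFin -EFinM lee_fin.
  have E0 : 0 <= intRn (zero_ext Omega (weight_energy F p Omega v)).
    by apply: intRn_ge0; [exact: cc_energy|exact: energy_ge0].
  (* The energy may vanish, so the estimate is applied to the energy plus [e / C]. *)
  apply/ler_addgt0Pr => e e0; have eC : 0 < e / C by rewrite divr_gt0.
  apply: le_trans (HC Omega v Od Cv _ (ltr_wpDl E0 eC) _) _.
    by rewrite lerDl ltW.
  by rewrite mulrDr (mulrC C (e / C)) divfK ?gt_eqF.
rewrite bE; set a := 1 - alpha in b0 D0 qE *.
(* The first case is exactly nonnegativity of [1 - (p * a)^-1]; this value is at most [1 - p^-1]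
   because [a <= 1]. *)
have [pa|pa] := leP 1 (p * a).
  have pa0 : 0 < p * a by exact: lt_le_trans pa.
  have t0 : 0 <= 1 - (p * a)^-1 by rewrite subr_ge0 invf_le1.
  have tp : 0 <= 1 - (p * a)^-1 <= 1 - p^-1.
    rewrite t0 lerD2l lerN2 lef_pV2 ?posrE //.
    by rewrite ler_piMr ?(ltW p0) // /a gerBl.
  have bge0 : 0 <= a - p^-1.
    by rewrite subr_ge0 -[p^-1]mul1r ler_pdivrMr // mulrC.
  have qp : 0 <= q - p.
    rewrite subr_ge0 qE ler_pdivlMr // mulrC ler_pM2r //.
    by rewrite gerBl ltW.
  apply: (main_estimate_absorb hF p1 q0 tp (erefl _) (erefl _)).
  - by rewrite mulr_ge0 // addr_ge0 // mulr_ge0 // ltW.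
  - by apply: le_trans p1 _; rewrite lerDl mulr_ge0.
  - by rewrite qE; exact: sobolev_exponent_weight.
  - by rewrite qE; exact: sobolev_exponent_power.
  - by rewrite qE; exact: absorbed_exponent.
have x10 : 0 < m.+1%:R + 1 :> R by rewrite addr_gt0.
apply: (main_estimate_hardy hF p1 q0 (erefl _)).
- apply/andP; split.
    rewrite qE hardy_exponent_weight // -qE.
    apply: divr_ge0; last exact: ltW.
    by apply: mulr_ge0 => //; apply: mulr_ge0; exact: ltW.
  (* [p * a < 1] means that the weight exponent [a - p^-1] is negative, which puts the parameter
     below 1. *)
  rewrite gtrDl pmulr_llt0 // subr_lt0 -[p^-1]mul1r ltr_pdivlMr // mulrC.
  exact: pa.
- by rewrite qE; exact: hardy_exponent_power.
- by rewrite qE; exact: hardy_exponent_ratio.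
Qed.
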